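(* Let $\mathbf{L}\in\mathbb{R}^{n\times n}$ be symmetric with spectrum in $[0,\Lambda]$, $\Lambda>0$, let $\phi$ be a positive function on $[0,\Lambda]$, and let $\mathrm{E}_W\in\mathbb{R}^{n\times N}$ be a block of $N$ distinct canonical unit vectors of $\mathbb{R}^n$. Let $$E_m(\phi)=\inf_{p\in\Pi_m}\ \sup_{\lambda\in[0,\Lambda]}|\phi(\lambda)-p(\lambda)|$$ denote the best approximation error of $\phi$ in the space $\Pi_m$ of polynomials of degree at most $m$ on $[0,\Lambda]$. Then for all three block Lanczos methods $\mathrm{kr}\in\{\mathrm{cbl},\mathrm{gbl},\mathrm{sbl}\}$ and every $m\ge 0$, $$\left\|\phi(\mathbf{L})\mathrm{E}_W-p_{\phi,m}^{(\mathrm{kr})}(\mathbf{L})\mathrm{E}_W\right\|_F\le 2\sqrt{N}\,E_m(\phi),$$ and for the Chebyshev method and every $m\ge 1$, $$\left\|\phi(\mathbf{L})\mathrm{E}_W-p_{\phi,m}^{(\mathrm{cheb})}(\mathbf{L})\mathrm{E}_W\right\|_F\le \sqrt{N}\left(2+\tfrac{2}{\pi}\log(m+1)\right)E_m(\phi).$$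
   Context: $A^*$ denotes the transpose, $\|\cdot\|_F$ the Frobenius norm. For a symmetric matrix $M$ with spectrum in $[0,\Lambda]$, $\phi(M)$ is defined through the spectral decomposition. $\mathrm{E}_W=[e_{\mathrm{w}_1},\ldots,e_{\mathrm{w}_N}]$. The iterates below are stated with $M\ge1$ Lanczos steps and carry the index $M-1$; in the claim one takes $M=m+1$. Each expression $p_{\phi,M-1}^{(\mathrm{kr})}(\mathbf{L})\mathrm{E}_W$ for a Lanczos method is one symbol for an $n\times N$ matrix. (cbl) Classical block Lanczos. Set $\mathrm{Q}_0=0$, $\mathrm{H}_{0,1}=0$, $\mathrm{Q}_1=\mathrm{E}_W$. For $k=1,2,\ldots$: $\mathrm{X}=\mathbf{L}\mathrm{Q}_k-\mathrm{Q}_{k-1}\mathrm{H}_{k-1,k}$, $\mathrm{H}_{k,k}=\mathrm{Q}_k^*\mathrm{X}$, replace $\mathrm{X}$ by $\mathrm{X}-\mathrm{Q}_k\mathrm{H}_{k,k}$, compute a reduced QR decomposition $\mathrm{X}=\mathrm{Q}_{k+1}\mathrm{H}_{k+1,k}$ ($\mathrm{Q}_{k+1}\in\mathbb{R}^{n\times N}$ with orthonormal columns, $\mathrm{H}_{k+1,k}\in\mathbb{R}^{N\times N}$ upper triangular), and set $\mathrm{H}_{k,k+1}=\mathrm{H}_{k+1,k}^*$. Let $\mathbf{H}_M\in\mathbb{R}^{MN\times MN}$ be the block tridiagonal matrix with blocks $\mathrm{H}_{i,j}$, $|i-j|\le1$, $1\le i,j\le M$, and $\mathrm{F}_1\in\mathbb{R}^{MN\times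 N}$ the matrix with first $N\times N$ block $\mathbf{I}_N$ and zeros elsewhere. Then $p_{\phi,M-1}^{(\mathrm{cbl})}(\mathbf{L})\mathrm{E}_W:=[\mathrm{Q}_1,\ldots,\mathrm{Q}_M]\phi(\mathbf{H}_M)\mathrm{F}_1$. (gbl) Global block Lanczos. Set $\mathrm{Q}_0=0$, $h_{0,1}=0$, $\mathrm{Q}_1=\mathrm{E}_W/\sqrt{N}$. For $k=1,2,\ldots$: $\mathrm{X}=\mathbf{L}\mathrm{Q}_k-h_{k-1,k}\mathrm{Q}_{k-1}$, $h_{k,k}=\operatorname{tr}(\mathrm{Q}_k^*\mathrm{X})$, replace $\mathrm{X}$ by $\mathrm{X}-h_{k,k}\mathrm{Q}_k$, $h_{k+1,k}=h_{k,k+1}=\|\mathrm{X}\|_F$, $\mathrm{Q}_{k+1}=\mathrm{X}/h_{k+1,k}$. Let $\mathbf{H}_M\in\mathbb{R}^{M\times M}$ be the symmetric tridiagonal matrix with entries $h_{i,j}$, $f_1$ the first canonical vector of $\mathbb{R}^M$, and $u=\sqrt{N}\,\phi(\mathbf{H}_M)f_1$. Then $p_{\phi,M-1}^{(\mathrm{gbl})}(\mathbf{L})\mathrm{E}_W:=\sum_{k=1}^M u_k\mathrm{Q}_k$. (sbl) Sequential Lanczos. For each $i$, run the ordinary Lanczos method with starting vector $e_{\mathrm{w}_i}$: set $q_0^{(\mathrm{w}_i)}=0$, $h_{0,1}^{(\mathrm{w}_i)}=0$, $q_1^{(\mathrm{w}_i)}=e_{\mathrm{w}_i}$, and for $k=1,2,\ldots$: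 $x=\mathbf{L}q_k^{(\mathrm{w}_i)}-h_{k-1,k}^{(\mathrm{w}_i)}q_{k-1}^{(\mathrm{w}_i)}$, $h_{k,k}^{(\mathrm{w}_i)}=(q_k^{(\mathrm{w}_i)})^*x$, replace $x$ by $x-h_{k,k}^{(\mathrm{w}_i)}q_k^{(\mathrm{w}_i)}$, $h_{k+1,k}^{(\mathrm{w}_i)}=h_{k,k+1}^{(\mathrm{w}_i)}=\|x\|_2$ (Euclidean norm), $q_{k+1}^{(\mathrm{w}_i)}=x/h_{k+1,k}^{(\mathrm{w}_i)}$. This gives vectors $q_1^{(\mathrm{w}_i)},\ldots,q_M^{(\mathrm{w}_i)}\in\mathbb{R}^n$ and a symmetric tridiagonal matrix $\mathbf{H}_M^{(\mathrm{w}_i)}\in\mathbb{R}^{M\times M}$ with entries $h_{j,k}^{(\mathrm{w}_i)}$. The $i$-th column of $p_{\phi,M-1}^{(\mathrm{sbl})}(\mathbf{L})\mathrm{E}_W$ is $[q_1^{(\mathrm{w}_i)},\ldots,q_M^{(\mathrm{w}_i)}]\,\phi(\mathbf{H}_M^{(\mathrm{w}_i)})f_1$, with $f_1$ the first canonical vector of $\mathbb{R}^M$. It is assumed that no breakdown occurs in the $M$ steps: for $k=1,\ldots,M-1$ the blocks $\mathrm{H}_{k+1,k}$ are invertible (cbl), respectively the numbers $h_{k+1,k}$ are nonzero (gbl), respectively the numbers $h_{k+1,k}^{(\mathrm{w}_i)}$ are nonzero in each of the $N$ runs (sbl). (cheb) Chebyshev method. For $m\ge1$, $p_{\phi,m}^{(\mathrm{cheb})}$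 is the polynomial of degree at most $m$ interpolating $\phi$ at the $m+1$ dilated and shifted Chebyshev–Lobatto points $\frac{\Lambda}{2}\left(1-\cos\frac{\pi j}{m}\right)$, $j=0,\ldots,m$, and $p_{\phi,m}^{(\mathrm{cheb})}(\mathbf{L})\mathrm{E}_W$ is this polynomial evaluated at $\mathbf{L}$, multiplied by $\mathrm{E}_W$. *)

(* Defs.v *)
From HB Require Import structures.
From mathcomp Require Import all_boot all_order all_algebra.
From mathcomp Require Import all_classical all_reals all_analysis.
Set Implicit Arguments.
Unset Strict Implicit.
Unset Printing Implicit Defensive.
Import Order.TTheory GRing.Theory Num.Theory.
Import numFieldNormedType.Exports.
Local Open Scope classical_set_scope.
Local Open Scope ring_scope.

Section BlockLanczos.
Variable R : realType.

(* The norm `|A| that mathcomp-analysis puts on matrices is the sup norm. *)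
Definition frobenius p q (A : 'M[R]_(p, q)) : R :=
  Num.sqrt (\sum_i \sum_j A i j ^+ 2).

Definition norm2 p (x : 'cV[R]_p) : R := Num.sqrt (\sum_i x i 0 ^+ 2).

Definition spectral_decompositions p (A : 'M[R]_p) : set ('M[R]_p * 'rV[R]_p) :=
  [set Ud | Ud.1^T *m Ud.1 = 1%:M /\ A = Ud.1 *m diag_mx Ud.2 *m Ud.1^T].

(* phi(A) = U diag(phi(d)) U^T for a spectral decomposition A = U diag(d) U^T;
   the value does not depend on the decomposition, and one exists as soon as A
   is symmetric.  For other matrices it is a junk value. *)
Definition matfun (phi : R -> R) p (A : 'M[R]_p) : 'M[R]_p :=
  let Ud := xget (1%:M, 0) (spectral_decompositions A) in
  Ud.1 *m diag_mx (map_mx phi Ud.2) *m Ud.1^T.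

(* [e_(w 0), ..., e_(w (N-1))] *)
Definition unit_block n N (w : 'I_N -> 'I_n) : 'M[R]_(n, N) :=
  \matrix_(i, j) (i == w j)%:R.

Definition first_unit M : 'cV[R]_M := \col_(k < M) (k == 0%N :> nat)%:R.

(* The entries h j k of the recurrences are indexed from 1, those of matrices
   from 0. *)
Definition tridiag_mx M (h : nat -> nat -> R) : 'M[R]_M :=
  \matrix_(i < M, j < M)
    if (i <= j.+1)%N && (j <= i.+1)%N then h i.+1 j.+1 else 0.

Section Methods.
Variables (n N : nat) (phi : R -> R) (L : 'M[R]_n).

(* cbl, gbl, sbl: classical, global and sequential block Lanczos.
   A reduced QR decomposition is not unique, so that a run is not determined by
   its input.  In each method, the part of step k that produces the basis
   element of index k + 1 is only required for k < M. *)
Definition cbl_run (E : 'M[R]_(n, N)) (M : nat)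
    (Q : nat -> 'M[R]_(n, N)) (H : nat -> nat -> 'M[R]_N) : Prop :=
  [/\ Q 0%N = 0, H 0%N 1%N = 0, Q 1%N = E &
    forall k, (0 < k <= M)%N ->
      let X := L *m Q k - Q k.-1 *m H k.-1 k in
      H k k = (Q k)^T *m X /\
      ((k < M)%N ->
        [/\ X - Q k *m H k k = Q k.+1 *m H k.+1 k,
            (Q k.+1)^T *m Q k.+1 = 1%:M,
            forall i j : 'I_N, (j < i)%N -> H k.+1 k i j = 0 &
            H k k.+1 = (H k.+1 k)^T])].

Definition cbl_mx (M : nat) (H : nat -> nat -> 'M[R]_N) :
    'M[R]_(\sum_(i < M) N, \sum_(j < M) N) :=
  \mxblock_(i < M, j < M)
    (if (i <= j.+1)%N && (j <= i.+1)%N then H i.+1 j.+1 else 0).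

Definition cbl_approx (M : nat)
    (Q : nat -> 'M[R]_(n, N)) (H : nat -> nat -> 'M[R]_N) : 'M[R]_(n, N) :=
  (\mxrow_(k < M) Q k.+1) *m matfun phi (cbl_mx M H) *m
  (\mxcol_(k < M) (if k == 0%N :> nat then 1%:M else 0 : 'M[R]_N)).

Definition gbl_run (E : 'M[R]_(n, N)) (M : nat)
    (Q : nat -> 'M[R]_(n, N)) (h : nat -> nat -> R) : Prop :=
  [/\ Q 0%N = 0, h 0%N 1%N = 0, Q 1%N = (Num.sqrt N%:R)^-1 *: E &
    forall k, (0 < k <= M)%N ->
      let X := L *m Q k - h k.-1 k *: Q k.-1 in
      let X' := X - h k k *: Q k in
      h k k = \tr ((Q k)^T *m X) /\
      ((k < M)%N ->
        [/\ h k.+1 k = frobenius X', h k k.+1 = frobenius X' &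
            Q k.+1 = (h k.+1 k)^-1 *: X'])].

Definition gbl_approx (M : nat)
    (Q : nat -> 'M[R]_(n, N)) (h : nat -> nat -> R) : 'M[R]_(n, N) :=
  let u := Num.sqrt N%:R *: (matfun phi (tridiag_mx M h) *m first_unit M) in
  \sum_(k < M) u k 0 *: Q k.+1.

Definition lanczos_run (e : 'cV[R]_n) (M : nat)
    (q : nat -> 'cV[R]_n) (h : nat -> nat -> R) : Prop :=
  [/\ q 0%N = 0, h 0%N 1%N = 0, q 1%N = e &
    forall k, (0 < k <= M)%N ->
      let x := L *m q k - h k.-1 k *: q k.-1 in
      let x' := x - h k k *: q k in
      h k k = ((q k)^T *m x) 0 0 /\
      ((k < M)%N ->
        [/\ h k.+1 k = norm2 x', h k k.+1 = norm2 x' &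
            q k.+1 = (h k.+1 k)^-1 *: x'])].

Definition lanczos_approx (M : nat)
    (q : nat -> 'cV[R]_n) (h : nat -> nat -> R) : 'cV[R]_n :=
  (\matrix_(i < n, k < M) q k.+1 i 0) *m
  matfun phi (tridiag_mx M h) *m first_unit M.

Definition sbl_approx (M : nat)
    (q : 'I_N -> nat -> 'cV[R]_n) (h : 'I_N -> nat -> nat -> R) :
    'M[R]_(n, N) :=
  \matrix_(r < n, i < N) lanczos_approx M (q i) (h i) r 0.

End Methods.

Definition lobatto_point (Lambda : R) (m j : nat) : R :=
  Lambda / 2 * (1 - cos (pi * j%:R / m%:R)).

(* For 0 < m and 0 < Lambda exactly one polynomial satisfies the condition. *)
Definition cheb_poly (phi : R -> R) (Lambda : R) (m : nat) : {poly R} :=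
  xget 0 [set p : {poly R} | (size p <= m.+1)%N /\
    forall j, (j <= m)%N ->
      p.[lobatto_point Lambda m j] = phi (lobatto_point Lambda m j)].

(* Extended-real valued, since phi may be unbounded on [0, Lambda]. *)
Definition best_approx_error (phi : R -> R) (Lambda : R) (m : nat) : \bar R :=
  ereal_inf [set ereal_sup [set `|phi x - p.[x]|%:E | x in `[0, Lambda]]
            | p in [set p : {poly R} | (size p <= m.+1)%N]].

End BlockLanczos.

(* Main.v *)
Require Import Defs.
From HB Require Import structures.
From mathcomp Require Import all_boot all_order all_algebra.
From mathcomp Require Import all_classical all_reals all_analysis.
From mathcomp Require Import complex.
From mathcomp Require Import ring lra zify.
Set Implicit Arguments.
Unset Strict Implicit.
Unset Printing Implicit Defensive.
Import Order.TTheory GRing.Theory Num.Theory.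
Import numFieldNormedType.Exports.
Local Open Scope ring_scope.

(** Lanczos methods. Each method builds a basis Q_1, ..., Q_M that is orthonormal
    for an inner product with values in a ring of coefficients: N x N matrices for
    the classical block method, real numbers for the other two. The usual
    three-term argument works over such a ring (lanczos_orthonormal). Let V map
    coordinates to combinations of the basis. Then V is an isometry, the computed
    matrix H is the compression of L along V, so that its spectrum lies in
    [0, Lambda] too, and V (H ^ k F_1) = L ^ k V F_1 for k <= m because the powers
    of the banded matrix H reach the last level only at k = m (krylov_powers).
    Hence p (L) V F_1 = V (p (H) F_1) for every polynomial p of degree at most m,
    and
      phi (L) V F_1 - V (phi (H) F_1)
        = (phi - p) (L) V F_1 - V ((phi - p) (H) F_1)
    has norm at most twice the supremum of |phi - p| times the norm of F_1
    (krylov_error). For all this a symmetric real matrix has to be diagonalized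
    orthogonally (symmetric_diagonalization).

    Chebyshev method. If q has degree at most m and |phi - q| <= e on [0, Lambda],
    the interpolant of phi differs from q by a polynomial that is at most e in
    modulus at the interpolation points. It remains to bound the Lebesgue constant
    of the Chebyshev-Lobatto points by 1 + 2 / pi * ln (m + 1). With x = cos t the
    interpolation operator is the even part of trigonometric interpolation at 2 m
    equidistant angles, with the kernel sin (m t) cot (t / 2) / (2 m). Let t lie
    between two nodes and divide the gap in the ratio of s to pi - s, and put
    v = s (pi - s) / pi ^ 2 <= 1 / 4. The inequalities cot y <= 1 / y - y / 3 and
    sin s <= 4 v bound the sum of the moduli of the kernel by
      sum_(j < m) 4 v (2 j + 1) / (pi (j (j + 1) + v)) - pi v / 3.
    For m >= 2 this increases with v; at v = 1 / 4 it is 4 / pi times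
    1 + 1 / 3 + ... + 1 / (2 m - 1), minus pi / 12 (lebesgue_sum_le_ln). The odd
    harmonic sum minus ln m / 2 decreases with m, and its value at m = 2 leads to
    the claim, by a narrow margin that depends on the decimals of pi and ln 2. *)


(** * Elementary estimates for sine, cotangent, logarithm and pi *)

Section SineBounds.
Variable R : realType.
Implicit Types x y a b : R.

Lemma derive_ge0_le (f df : R -> R) a b : a <= b ->
  (forall x, a <= x <= b -> is_derive x 1 f (df x)) ->
  (forall x, a <= x <= b -> 0 <= df x) -> f a <= f b.
Proof.
move=> ab fd dfge0.
have [||c cab eqf] := @MVT_segment R f df a b ab.
- by move=> x /itvP xab; apply: fd; rewrite !xab.
- apply: continuous_in_subspaceT => x; rewrite inE /= in_itv/= => xab.
  have {}fd := fd x xab.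
  by apply: differentiable_continuous; apply/derivable1_diffP; exact: ex_derive.
- by rewrite -subr_ge0 eqf mulr_ge0 ?subr_ge0// dfge0// -in_itv.
Qed.

Lemma sin_le_id x : 0 <= x -> sin x <= x.
Proof.
move=> x0; have := @derive_ge0_le (fun t => t - sin t) (fun t => 1 - cos t) 0 x x0.
by rewrite sin0 subrr subr_ge0; apply=> t _; rewrite subr_ge0 cos_le1.
Qed.

Lemma cos_ge_taylor2 x : 0 <= x -> 1 - x ^+ 2 / 2 <= cos x.
Proof.
move=> x0.
have := @derive_ge0_le (fun t => cos t - (1 - t ^+ 2 / 2)) (fun t => t - sin t) 0 x x0.
rewrite cos0 expr0n /= mul0r subr0 subrr subr_ge0; apply=> t t0.
  apply: is_derive_eq; rewrite /GRing.scale/=; by field.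
by rewrite subr_ge0 sin_le_id//; case/andP: t0.
Qed.

Lemma sin_ge_taylor3 x : 0 <= x -> x - x ^+ 3 / 6 <= sin x.
Proof.
move=> x0.
have := @derive_ge0_le (fun t => sin t - (t - t ^+ 3 / 6))
  (fun t => cos t - (1 - t ^+ 2 / 2)) 0 x x0.
rewrite sin0 expr0n /= mul0r !subr0 subr_ge0; apply=> t t0.
  apply: is_derive_eq; rewrite /GRing.scale/=; by field.
by rewrite subr_ge0 cos_ge_taylor2//; case/andP: t0.
Qed.

Lemma cos_le_taylor4 x : 0 <= x -> cos x <= 1 - x ^+ 2 / 2 + x ^+ 4 / 24.
Proof.
move=> x0.
have := @derive_ge0_le (fun t => 1 - t ^+ 2 / 2 + t ^+ 4 / 24 - cos t)
  (fun t => sin t - (t - t ^+ 3 / 6)) 0 x x0.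
rewrite cos0 !expr0n /= !mul0r !subr0 addr0 subrr subr_ge0; apply=> t t0.
  apply: is_derive_eq; rewrite /GRing.scale/=; by field.
by rewrite subr_ge0 sin_ge_taylor3//; case/andP: t0.
Qed.

Lemma sin_le_taylor5 x : 0 <= x -> sin x <= x - x ^+ 3 / 6 + x ^+ 5 / 120.
Proof.
move=> x0.
have := @derive_ge0_le (fun t => t - t ^+ 3 / 6 + t ^+ 5 / 120 - sin t)
  (fun t => 1 - t ^+ 2 / 2 + t ^+ 4 / 24 - cos t) 0 x x0.
rewrite sin0 !expr0n /= !mul0r !subr0 addr0 subr_ge0; apply=> t t0.
  apply: is_derive_eq; rewrite /GRing.scale/=; by field.
by rewrite subr_ge0 cos_le_taylor4//; case/andP: t0.
Qed.

Lemma sin2_piquarter : sin (pi / 4) ^+ 2 = 2^-1 :> R.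
Proof.
have := cos_mulr2n (pi / 4 : R); rewrite cos2sin2 mulr2n -mulr2n.
have -> : (pi / 4 *+ 2 : R) = pi / 2 by rewrite -mulr_natr; by field.
rewrite cos_pihalf; lra.
Qed.

Lemma sin_piquarter_gt0 : 0 < sin (pi / 4) :> R.
Proof. by apply: sin_gt0_pihalf; have := @pi_gt0 R; lra. Qed.

(** Since sin (pi / 4) ^ 2 = 1 / 2, Taylor enclosures of sin decide on which side
    of pi / 4 a rational number lies. The lower bound is needed with two correct
    decimals: the final estimate of the Lebesgue constant would fail for pi = 3.13. *)
Lemma pi_bounds : 314 / 100 < pi :> R /\ pi < 36 / 10 :> R.
Proof.
have p0 := @pi_gt0 R; have s0 := sin_piquarter_gt0; have s2 := sin2_piquarter.
have p2 := @pi_ge2 R.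
split; rewrite ltNge; apply/negP => ple.
  have : sin (pi / 4) <= sin (785 / 1000 : R).
    by rewrite leNgt ltr_sin ?in_itv -?leNgt /=; lra.
  move=> /le_trans/(_ (sin_le_taylor5 _))-/(_ ltac:(lra)) sle.
  have : sin (pi / 4) * sin (pi / 4) <= (7069 / 10000) * (7069 / 10000) :> R.
    by apply: ler_pM; lra.
  by rewrite -!expr2 s2; lra.
have : sin (9 / 10 : R) <= sin (pi / 4).
  by rewrite leNgt ltr_sin ?in_itv -?leNgt /=; lra.
move=> /(le_trans (sin_ge_taylor3 _))-/(_ ltac:(lra)) sge.
have : (75 / 100) * (75 / 100) <= sin (pi / 4) * sin (pi / 4) :> R.
  by apply: ler_pM; lra.
by rewrite -!expr2 s2; lra.
Qed.

Lemma mul_cos_le_sin x : 0 <= x <= pi -> x * cos x <= sin x.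
Proof.
move=> /andP[x0 xpi].
have := @derive_ge0_le (fun t => sin t - t * cos t) (fun t => t * sin t) 0 x x0.
rewrite sin0 mul0r subrr subr_ge0; apply=> t /andP[t0 tx].
  apply: is_derive_eq; rewrite /GRing.scale/=; by ring.
by rewrite mulr_ge0// sin_ge0_pi// t0 (le_trans tx).
Qed.

(** This is cot x <= 1 / x - x / 3 without division. The bound 1 / x alone would
    make the constant term of the Lebesgue bound about 1.25 instead of 1. *)
Lemma cot_taylor x : 0 <= x <= pi -> x * cos x <= (1 - x ^+ 2 / 3) * sin x.
Proof.
move=> /andP[x0 xpi].
have := @derive_ge0_le (fun t => (1 - t ^+ 2 / 3) * sin t - t * cos t)
   (fun t => t / 3 * (sin t - t * cos t)) 0 x x0.
rewrite sin0 !mul0r mulr0 subrr subr_ge0; apply=> t /andP[t0 tx].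
  apply: is_derive_eq; rewrite /GRing.scale/=; by field.
by rewrite mulr_ge0 ?divr_ge0// subr_ge0 mul_cos_le_sin// t0 (le_trans tx).
Qed.

(** Both sides agree at a = x, and the derivative of the difference with respect
    to a is sin x - x * cos a, which is at least sin x - x * cos x >= 0. *)
Lemma sin_chord x a : 0 <= x <= a -> a <= pi -> x * sin a <= a * sin x.
Proof.
move=> /andP[x0 xa] api.
have := @derive_ge0_le (fun t => t * sin x - x * sin t)
   (fun t => sin x - x * cos t) x a xa.
rewrite subrr subr_ge0; apply=> t /andP[xt ta].
  apply: is_derive_eq; rewrite /GRing.scale/=; by ring.
rewrite subr_ge0 (le_trans _ (mul_cos_le_sin _)) ?x0 ?(le_trans xa)// ler_wpM2l//.
by rewrite leNgt ltr_cos ?in_itv/= ?x0 -?leNgt//=; lra.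
Qed.

(** With s = |pi / 2 - x| the claim reads 2 * sin (s / 2) ^ 2 >= 4 * s ^ 2 / pi ^ 2,
    which is the square of a chord inequality on [0, pi / 4]. *)
Lemma sin_le_parabola x : 0 <= x <= pi -> pi ^+ 2 * sin x <= 4 * (x * (pi - x)).
Proof.
move=> xpi; have p0 := @pi_gt0 R.
have -> : sin x = cos `|pi / 2 - x|.
  by rewrite cos_norm -cosBpihalf -cosN; congr cos; by ring.
have : (`|pi / 2 - x|) ^+ 2 = (pi / 2 - x) ^+ 2 by rewrite real_normK ?num_real.
have : `|pi / 2 - x| <= pi / 2 by rewrite ler_norml; lra.
have := normr_ge0 (pi / 2 - x); move: `|_| => s s0 sp s2.
have -> : cos s = 1 - 2 * sin (s / 2) ^+ 2.
  rewrite {1}(splitr s) -mulr2n cos_mulr2n cos2sin2; by ring.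
have ch : s / 2 * sin (pi / 4) <= pi / 4 * sin (s / 2).
  by apply: sin_chord; lra.
have : (s / 2 * sin (pi / 4)) ^+ 2 <= (pi / 4 * sin (s / 2)) ^+ 2.
  rewrite ler_pXn2r ?nnegrE ?mulr_ge0 ?(ltW sin_piquarter_gt0)//; try lra.
  by apply: sin_ge0_pi; lra.
rewrite !exprMn sin2_piquarter s2 -subr_ge0 => {}ch.
rewrite -subr_ge0; have /(mulr_ge0 _) := ch => /(_ 32 ltac:(by [])).
by congr (_ <= _); field.
Qed.

(** At x = 1 / m this is sharp enough to make the m-th odd harmonic sum minus
    ln m / 2 decreasing in m. *)
Lemma ln1D_ge x : 0 <= x -> 2 * x / (2 + x) <= ln (1 + x).
Proof.
move=> x0; rewrite ler_pdivrMr; last by lra.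
have := @derive_ge0_le (fun t => ln (1 + t) * (2 + t) - 2 * t)
   (fun t => ln (1 + t) + (1 + t)^-1 - 1) 0 x x0.
rewrite !(addr0, mulr0, mul0r) ln1 mul0r subr0 subr_ge0; apply=> t /andP[t0 tx].
  have t1 : 0 < 1 + t by lra.
  have dln : is_derive t 1 (fun u => ln (1 + u)) (1 + t)^-1.
    have dln := is_derive1_ln t1.
    have d1 : is_derive t 1 (fun u : R => 1 + u) 1.
      rewrite -[X in is_derive _ _ _ X]add0r.
      exact: (@is_deriveD R R R (fun=> 1) id).
    have := @is_derive1_comp R (@ln R) (fun u : R => 1 + u) t _ _ dln d1.
    by rewrite mulr1; apply.
  apply: is_derive_eq; rewrite /GRing.scale/=; field; lra.
have t1 : 0 < 1 + t by lra.
have -> : ln (1 + t) = - ln (1 + ((1 + t)^-1 - 1)).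
  by rewrite [1 + (_ - 1)]addrC subrK lnV ?opprK.
have := @le_ln1Dx R ((1 + t)^-1 - 1).
have : 0 < (1 + t)^-1 by rewrite invr_gt0.
by move: (_^-1) => u u0; move: (ln _) => l; lra.
Qed.
End SineBounds.

(** * The Lebesgue constant of the Chebyshev-Lobatto points *)

Section InterpolationKernel.
Variable R : realType.
Implicit Types a t r s v : R.

(** The kernel sin (m * t) * cot (t / 2) / (2 * m) of trigonometric interpolation
    at 2 * m equidistant angles, written as a cosine sum so that it is defined
    at t = 0. *)
Definition dker (m : nat) t : R :=
  (2 * m%:R)^-1 * \sum_(k < m) (cos (k%:R * t) + cos (k.+1%:R * t)).

(** The cosines of the nodes of index at most m are the Chebyshev-Lobatto points;
    the nodes of index below 2 * m go once around the circle. *)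
Definition node (m j : nat) : R := j%:R * (pi / m%:R).

(** Each summand, multiplied by sin (t / 2), is cos (t / 2) times a difference of
    consecutive sines, so that the sum telescopes. *)
Lemma dker_mul_sin m t : (0 < m)%N ->
  2 * m%:R * dker m t * sin (t / 2) = sin (m%:R * t) * cos (t / 2).
Proof.
move=> m0; have m1 : 2 * m%:R != 0 :> R by rewrite mulf_neq0 ?pnatr_eq0 -?lt0n.
rewrite /dker mulVKf// mulr_suml.
pose f k := cos (t / 2) * sin (k%:R * t).
rewrite (eq_bigr (fun k : 'I_m => f k.+1 - f k)).
  rewrite -(big_mkord xpredT (fun k => f k.+1 - f k)) telescope_sumr// /f.
  by rewrite mul0r sin0 mulr0 subr0 mulrC.
move=> k _; rewrite /f; set s := k%:R * t + t / 2.
have -> : k.+1%:R * t = s + t / 2 by rewrite -natr1 /s; field.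
have -> : k%:R * t = s - t / 2 by rewrite /s addrK.
move: s => s; rewrite cosB cosD sinB sinD; ring.
Qed.

Lemma dkerN m t : dker m (- t) = dker m t.
Proof. by congr (_ * _); apply: eq_bigr => k _; rewrite !mulrN !cosN. Qed.

Lemma dker_periodic m : periodic (dker m) (pi *+ 2).
Proof.
move=> t; congr (_ * _); apply: eq_bigr => k _.
have cosn (n : nat) : cos (n%:R * (t + pi *+ 2)) = cos (n%:R * t).
  by rewrite mulrDr [n%:R * (_ *+ 2)]mulr_natl (periodicn (@cosD2pi R)).
by rewrite !cosn.
Qed.

Lemma dker0 m : (0 < m)%N -> dker m 0 = 1.
Proof.
move=> m0; rewrite /dker; under eq_bigr do rewrite !mulr0 cos0.
rewrite sumr_const card_ord -[(1 + 1) *+ m]mulr_natr -[1 + 1]/(2 : R).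
by rewrite mulVf// mulf_neq0 ?pnatr_eq0 -?lt0n.
Qed.

Lemma sin_nat_pi (n : nat) : sin (n%:R * pi) = 0 :> R.
Proof.
have := alternatingn (@sinDpi R) n 0.
by rewrite add0r mulr_natl sin0 mulr0.
Qed.

Lemma norm_sinD_nat_pi (n : nat) t : `|sin (t + n%:R * pi)| = `|sin t|.
Proof.
by rewrite mulr_natl (alternatingn (@sinDpi R)) normrM normrX normrN1 expr1n mul1r.
Qed.

Lemma mul_node m j : (0 < m)%N -> m%:R * node m j = j%:R * pi.
Proof. by move=> m0; rewrite /node mulrCA [m%:R * _]mulrC divfK// pnatr_eq0 -lt0n. Qed.

Lemma dker_node m j : (0 < j < 2 * m)%N -> dker m (node m j) = 0.
Proof.
move=> /andP[j0 jm]; have m0 : (0 < m)%N by case: m jm => //; rewrite muln0.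
have mR : 0 < m%:R :> R by rewrite ltr0n.
have s0 : 0 < sin (node m j / 2).
  apply: sin_gt0_pi; rewrite divr_gt0 ?mulr_gt0 ?ltr0n ?divr_gt0 ?pi_gt0 ?invr_gt0//=.
  have -> : node m j / 2 = pi * (j%:R / (2 * m%:R)).
    by rewrite /node; field; rewrite gt_eqF.
  rewrite gtr_pMr ?pi_gt0// ltr_pdivrMr ?mulr_gt0// mul1r.
  by rewrite -(natrM R 2) ltr_nat.
have := dker_mul_sin (node m j) m0.
rewrite mul_node// sin_nat_pi mul0r => /eqP.
by rewrite mulf_eq0 (gt_eqF s0) orbF mulf_eq0 gt_eqF ?mulr_gt0//= => /eqP.
Qed.

Lemma node_shift m i j : node m (i + j) = node m i + node m j.
Proof. by rewrite /node natrD mulrDl. Qed.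

Lemma node_2m m : (0 < m)%N -> node m (2 * m) = pi *+ 2.
Proof.
move=> m0; rewrite /node natrM -mulr_natl; field.
by rewrite pnatr_eq0 -lt0n.
Qed.

(** The Lebesgue function of trigonometric interpolation. It dominates that of
    polynomial interpolation at the Lobatto points. *)
Definition lebesgue_sum (m : nat) a : R :=
  \sum_(j < 2 * m) `|dker m (a + node m j)|.

(** Moving by one node permutes the nodes on the circle. *)
Lemma lebesgue_sum_node m a n : (0 < m)%N ->
  lebesgue_sum m (a + node m n) = lebesgue_sum m a.
Proof.
move=> m0; elim: n => [|n IHn]; first by rewrite /node mul0r addr0.
rewrite -addn1 node_shift addrA -{}IHn; move: (a + node m n) => {}a.
rewrite /lebesgue_sum -!(big_mkord xpredT (fun j => `|dker m (_ + node m j)|)).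
have -> : (2 * m = (2 * m).-1.+1)%N by rewrite prednK// muln_gt0.
rewrite [LHS]big_nat_recr//= [RHS]big_nat_recl//= addrC; congr (_ + _).
  rewrite -addrA -node_shift add1n prednK ?muln_gt0// node_2m//.
  by rewrite dker_periodic /node mul0r addr0.
by apply: eq_bigr => j _; rewrite -addrA -node_shift add1n.
Qed.

Lemma lebesgue_sum0 m : (0 < m)%N -> lebesgue_sum m 0 = 1.
Proof.
move=> m0; rewrite /lebesgue_sum.
have m2 : (0 < 2 * m)%N by rewrite muln_gt0.
rewrite (bigD1 (Ordinal m2))//= /node mul0r addr0 dker0// normr1.
rewrite big1 ?addr0// => j j0; rewrite add0r -/(node m j) dker_node ?normr0//.
by rewrite ltn_ord andbT lt0n.
Qed.

(** The kernel being even and 2 * pi-periodic, the second half of the circle is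
    seen from r as the first half is from the mirror image pi / m - r of r. *)
Lemma lebesgue_sum_fold m r : (0 < m)%N ->
  lebesgue_sum m r = \sum_(j < m)
    (`|dker m (r + node m j)| + `|dker m (pi / m%:R - r + node m j)|).
Proof.
move=> m0; rewrite big_split /= /lebesgue_sum mul2n -addnn big_split_ord /=.
congr (_ + _); rewrite [RHS](reindex_inj rev_ord_inj); apply: eq_bigr => j _ /=.
rewrite -[in RHS]dkerN -[in RHS]dker_periodic -(node_2m m0); congr (`|dker m _|).
rewrite /node mul2n -addnn !natrD natrB//= -natr1; field.
by rewrite pnatr_eq0 -lt0n.
Qed.

(** With y = s / (2 * m) this is the cotangent inequality at y; the bracket is
    nonnegative because cot y is. *)
Lemma dker_le m s : (0 < m)%N -> 0 < s < m%:R * pi ->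
  0 <= s^-1 - s / (12 * m%:R ^+ 2) /\
  `|dker m (s / m%:R)| <= `|sin s| * (s^-1 - s / (12 * m%:R ^+ 2)).
Proof.
move=> m0 /andP[s0 sm]; have mR : 0 < m%:R :> R by rewrite ltr0n.
set y := s / m%:R / 2; have y0 : 0 < y by rewrite !divr_gt0.
have ypi : y < pi / 2 by rewrite /y ltr_pM2r// ltr_pdivrMr// mulrC.
have siny : 0 < sin y by rewrite sin_gt0_pihalf ?y0.
have cosy : 0 < cos y by rewrite cos_gt0_pihalf ?ypi ?andbT//; lra.
have -> : s^-1 - s / (12 * m%:R ^+ 2) = (2 * m%:R * y)^-1 * (1 - y ^+ 2 / 3).
  by rewrite /y; field; rewrite !gt_eqF.
have cot := @cot_taylor R y _; have {}cot := cot ltac:(lra).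
have q0 : 0 <= 1 - y ^+ 2 / 3.
  by rewrite -(pmulr_lge0 _ siny) (le_trans _ cot)// mulr_ge0 ?ltW.
split; first by rewrite mulr_ge0// invr_ge0 !mulr_ge0// ltW.
have kE := dker_mul_sin (s / m%:R) m0.
rewrite mulrC [m%:R * _]mulrC divfK ?gt_eqF// -/y in kE.
have -> : dker m (s / m%:R) = sin s * (cos y / (2 * m%:R * sin y)).
  rewrite mulrA -kE; field; by rewrite !gt_eqF.
rewrite normrM ler_wpM2l// ger0_norm ?divr_ge0 ?mulr_ge0 ?(ltW siny) ?(ltW cosy)//.
rewrite ler_pdivrMr ?mulr_gt0//.
rewrite [leRHS](_ : _ = (1 - y ^+ 2 / 3) * sin y / y); last first.
  by field; rewrite !gt_eqF.
by rewrite ler_pdivlMr// mulrC.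
Qed.

(** Adding the bounds at s + j * pi and pi - s + j * pi, the reciprocals combine
    into a fraction that depends on s through v only. The factor sin s is then
    replaced by the parabola 4 * v. *)
Lemma dker_pair_le m j s : (j < m)%N -> 0 < s < pi ->
  let v := s * (pi - s) / pi ^+ 2 in
  `|dker m (s / m%:R + node m j)| + `|dker m ((pi - s) / m%:R + node m j)|
    <= 4 * v * ((2 * j%:R + 1) / (pi * (j%:R * (j%:R + 1) + v))
                - (2 * j%:R + 1) * pi / (12 * m%:R ^+ 2)).
Proof.
move=> jm /andP[s0 spi] /=; set v := s * (pi - s) / pi ^+ 2.
have m0 : (0 < m)%N by case: m jm.
have p0 := @pi_gt0 R; have mR : 0 < m%:R :> R by rewrite ltr0n.
have jR : 0 <= j%:R :> R by [].
have jmR : j%:R + 1 <= m%:R :> R by rewrite natr1 ler_nat.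
have v0 : 0 < v by rewrite divr_gt0 ?mulr_gt0 ?exprn_gt0//; lra.
have shift t : t / m%:R + node m j = (t + j%:R * pi) / m%:R.
  by rewrite /node; field; rewrite gt_eqF.
have range t : 0 < t < pi -> 0 < t + j%:R * pi < m%:R * pi.
  move=> /andP[t0 tpi]; rewrite ltr_wpDr ?mulr_ge0 ?(ltW p0)//=.
  rewrite (@lt_le_trans _ _ ((j%:R + 1) * pi)) ?ler_wpM2r ?(ltW p0)//; lra.
have [a0 ale] := dker_le m0 (range s ltac:(lra)).
have [b0 ble] := dker_le m0 (range (pi - s) ltac:(lra)).
rewrite !shift (le_trans (lerD ale ble))//.
rewrite !norm_sinD_nat_pi [sin (pi - s)]sinB sinpi cospi mul0r mulN1r sub0r opprK.
rewrite (ger0_norm (sin_ge0_pi _)) ?(ltW s0) ?(ltW spi)// -mulrDr.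
have sle : sin s <= 4 * v.
  rewrite /v mulrA ler_pdivlMr ?exprn_gt0// mulrC sin_le_parabola//; lra.
rewrite (le_trans (ler_wpM2r (addr_ge0 a0 b0) sle))//.
rewrite le_eqVlt; apply/orP; left; apply/eqP; congr (_ * _).
rewrite /v; clear -s0 spi p0 mR jR; move: (pi : R) p0 spi => P P0 sP; field. 
have jP : 0 <= j%:R * P by rewrite mulr_ge0// ltW.
have sP0 : 0 < s * (P - s) by rewrite mulr_gt0// subr_gt0.
apply/and5P; split; rewrite gt_eqF//; try lra.
by rewrite ltr_wpDl// !mulr_ge0 ?addr_ge0 ?(ltW P0).
Qed.

Definition odd_harmonic (m : nat) : R := \sum_(j < m) (2 * j%:R + 1)^-1.

(** The difference of the two sides increases with m, by the lower bound for
    ln (1 + 1 / m), and vanishes for m = 2. *)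
Lemma odd_harmonic_le m : (1 < m)%N ->
  odd_harmonic m <= 4 / 3 - ln 2 / 2 + ln m%:R / 2.
Proof.
case: m => [|[|m]]// _; elim: m => [|m IHm].
  rewrite /odd_harmonic !big_ord_recr big_ord0 /= add0r.
  have -> : (2 * 0%:R + 1)^-1 + (2 * 1%:R + 1)^-1 = 4 / 3 :> R by field.
  lra.
rewrite /odd_harmonic big_ord_recr /= -/(odd_harmonic _).
have m0 : 0 < m.+2%:R :> R by [].
have -> : m.+3%:R = m.+2%:R * (1 + m.+2%:R^-1) :> R.
  by rewrite mulrDr mulfV ?gt_eqF// mulr1 natr1.
rewrite lnM ?posrE ?addr_gt0 ?invr_gt0//.
have : 0 <= m.+2%:R^-1 :> R by rewrite invr_ge0.
move=> /ln1D_ge; move: (ln (1 + _)) => l.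
have -> : 2 * m.+2%:R^-1 / (2 + m.+2%:R^-1) = 2 * (2 * m.+2%:R + 1)^-1 :> R.
  by field; rewrite !gt_eqF// addr_gt0// mulr_gt0.
move: IHm; move: (_^-1) (odd_harmonic _) (ln m.+2%:R) (ln 2) => *; lra.
Qed.

Lemma pi_sqr_ge : (314 / 100) ^+ 2 <= pi ^+ 2 :> R.
Proof.
have [p1 _] := @pi_bounds R; move: (pi : R) p1 => p p1.
rewrite -subr_ge0 subr_sqr; apply: mulr_ge0; lra.
Qed.

Lemma ln2_ge : 686 / 1000 <= ln 2 :> R.
Proof.
have h x c : 0 <= x -> c * (2 + x) <= 2 * x -> c <= ln (1 + x) :> R.
  by move=> x0 cx; rewrite (le_trans _ (ln1D_ge x0))// ler_pdivlMr//; lra.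
have -> : 2 = (1 + 3^-1) * ((1 + 4^-1) * (1 + 5^-1)) :> R by field.
rewrite !lnM ?posrE; try lra.
have := h 3^-1 (2 / 7) ltac:(lra) ltac:(lra).
have := h 4^-1 (2 / 9) ltac:(lra) ltac:(lra).
have := h 5^-1 (2 / 11) ltac:(lra) ltac:(lra).
by move: (ln (1 + 3^-1)) (ln (1 + 4^-1)) (ln (1 + 5^-1)) => a b c; lra.
Qed.

Lemma sum_odd m : \sum_(j < m) (2 * j%:R + 1) = m%:R ^+ 2 :> R.
Proof.
elim: m => [|m IHm]; first by rewrite big_ord0 expr0n.
by rewrite big_ord_recr /= IHm -natr1; ring.
Qed.

(** The left-hand side is nondecreasing in v; the right-hand side is its value at
    v = 1 / 4, which corresponds to the midpoint between two nodes. *)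
Lemma pair_term_le (j : nat) v : 0 < v <= 1 / 4 ->
  4 * v * ((2 * j%:R + 1) / (pi * (j%:R * (j%:R + 1) + v)))
    <= 4 / pi * (2 * j%:R + 1)^-1.
Proof.
move=> /andP[v0 v1]; have p0 := @pi_gt0 R; have j0 : 0 <= j%:R :> R by [].
have j1 : 0 <= j%:R * (j%:R + 1) :> R by rewrite mulr_ge0// addr_ge0.
have d0 : 0 < j%:R * (j%:R + 1) + v by rewrite ltr_wpDl.
have e0 : 0 < 2 * j%:R + 1 :> R by lra.
rewrite -subr_ge0 [X in 0 <= X](_ : _ =
  4 * (j%:R * (j%:R + 1) * (1 - 4 * v)) /
    (pi * (j%:R * (j%:R + 1) + v) * (2 * j%:R + 1))).
  apply: divr_ge0; last by rewrite !mulr_ge0 ?ltW.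
  by rewrite mulr_ge0// mulr_ge0//; lra.
by move: (pi : R) p0 => P P0; field; rewrite !gt_eqF.
Qed.

(** The terms - y / 3 of the cotangent bound contribute - pi / 3 * v in total,
    which decreases with v. The term of index 1 increases fast enough to make up
    for it, so that v = 1 / 4 remains the worst case. *)
Lemma pair_term1_le v : 0 < v <= 1 / 4 ->
  4 * v * ((2 * 1 + 1) / (pi * (1 * (1 + 1) + v)))
    <= 4 / pi * (2 * 1 + 1)^-1 - pi / 3 * (1 / 4 - v).
Proof.
move=> /andP[v0 v1]; have p0 := @pi_gt0 R; have [_ p1] := @pi_bounds R.
have d0 : 0 < 2 + v by lra.
rewrite -subr_ge0 [X in 0 <= X](_ : _ =
  (1 / 4 - v) * (32 - pi ^+ 2 * (2 + v)) / (3 * pi * (2 + v))).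
  apply: divr_ge0; last by rewrite !mulr_ge0 ?ltW.
  apply: mulr_ge0; first by lra.
  have : pi ^+ 2 <= (36 / 10) ^+ 2 :> R.
    by rewrite ler_pXn2r ?nnegrE ?(ltW p0) ?(ltW p1)//; lra.
  have : 0 <= pi ^+ 2 :> R by rewrite sqr_ge0.
  move: (pi ^+ 2) => q q0 q1; nra.
by move: (pi : R) p0 => P P0; field; rewrite !gt_eqF.
Qed.

Lemma lebesgue_sum_le_ln m a : (0 < m)%N -> 0 <= a ->
  lebesgue_sum m a <= 1 + 2 / pi * ln m.+1%:R.
Proof.
move=> m0 a0; have p0 := @pi_gt0 R; have [p1 p2] := @pi_bounds R.
have mR : 0 < m%:R :> R by rewrite ltr0n.
have h0 : 0 < pi / m%:R :> R by rewrite divr_gt0.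
(* By periodicity a may be taken between the first two nodes. *)
have /andP[] := truncn_itv (divr_ge0 a0 (ltW h0)).
set n := Num.truncn _; rewrite ler_pdivlMr// ltr_pdivrMr// -/(node m n) => na an.
have -> : a = (a - node m n) + node m n by rewrite subrK.
rewrite lebesgue_sum_node//.
have : a - node m n < pi / m%:R.
  by rewrite ltrBlDr (lt_le_trans an)// -add1n natrD mulrDl mul1r.
have : 0 <= a - node m n by rewrite subr_ge0.
move: (a - _) => {a0 na an n}a; rewrite le_eqVlt => /predU1P[<- _|a0 ah].
  rewrite lebesgue_sum0// lerDl mulr_ge0 ?divr_ge0 ?(ltW p0)// ln_ge0//.
  by rewrite ler1n.
pose s := m%:R * a.
have s0 : 0 < s by rewrite mulr_gt0.
have sp : s < pi by rewrite /s mulrC -ltr_pdivlMr.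
pose v := s * (pi - s) / pi ^+ 2.
have v0 : 0 < v by rewrite divr_gt0 ?mulr_gt0 ?exprn_gt0// subr_gt0.
have v1 : v <= 1 / 4.
  rewrite ler_pdivrMr ?exprn_gt0// -subr_ge0.
  have -> : 1 / 4 * pi ^+ 2 - s * (pi - s) = (pi / 2 - s) ^+ 2.
    by move: (pi : R) => P; field.
  exact: sqr_ge0.
have : lebesgue_sum m a <= \sum_(j < m)
    4 * v * ((2 * j%:R + 1) / (pi * (j%:R * (j%:R + 1) + v))) - pi / 3 * v.
  have -> : pi / 3 * v = \sum_(j < m) 4 * v * ((2 * j%:R + 1) * pi / (12 * m%:R ^+ 2)).
    rewrite -mulr_sumr -!mulr_suml sum_odd.
    by move: (pi : R) => P; field; rewrite gt_eqF.
  rewrite -sumrB lebesgue_sum_fold//; apply: ler_sum => j _.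
  rewrite -mulrBr; have := @dker_pair_le m j s (ltn_ord j); rewrite s0 sp => /(_ isT).
  have -> : s / m%:R = a by rewrite /s mulrC mulKf// gt_eqF.
  have -> // : (pi - s) / m%:R = pi / m%:R - a.
  by rewrite mulrBl /s [_ * a]mulrC mulfK// gt_eqF.
move=> /le_trans; apply.
have lnS : ln m%:R <= ln m.+1%:R :> R by rewrite ler_ln ?posrE ?ltr0n// ler_nat.
have toln (b : R) : b * pi <= pi + 2 * ln m.+1%:R -> b <= 1 + 2 / pi * ln m.+1%:R.
  have -> : 1 + 2 / pi * ln m.+1%:R = (pi + 2 * ln m.+1%:R) / pi :> R.
    by move: (ln _) (pi : R) p0 => l P P0; field; rewrite gt_eqF.
  by rewrite ler_pdivlMr.
apply: toln; have v01 : 0 < v <= 1 / 4 by rewrite v0.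
move: v v0 v1 v01 => v v0 v1 v01; clear s s0 sp h0 ah mR.
(* For m = 1 there is no term of index 1, but the bound 4 / pi is enough. *)
case: (leqP m 1) => m1.
  have {m1 m0 lnS} -> : m = 1%N by apply/eqP; rewrite eqn_leq m1.
  have := pair_term_le 0 v01; rewrite big_ord1 /=; set S := 4 * v * _.
  rewrite mulr0 add0r invr1 mulr1 ler_pdivlMr// mulrBl.
  have := ln2_ge; have : 0 <= pi / 3 * v * pi by rewrite !mulr_ge0 ?ltW.
  move: (_ * _ * pi) (S * pi) (ln _) => x y l; lra.
have : \sum_(j < m) 4 * v * ((2 * j%:R + 1) / (pi * (j%:R * (j%:R + 1) + v)))
    <= 4 / pi * odd_harmonic m - pi / 3 * (1 / 4 - v).
  case: m m1 {m0 lnS} => [|[|m]]// _.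
  rewrite /odd_harmonic mulr_sumr !big_ord_recl /= -!addrA.
  apply: lerD; first exact: pair_term_le.
  rewrite addrA addrAC; apply: lerD; first exact: pair_term1_le.
  by apply: ler_sum => j _; exact: pair_term_le.
move=> sle; apply: (@le_trans _ _ ((4 / pi * odd_harmonic m - pi / 12) * pi)).
  rewrite ler_pM2r//; move: sle; lra.
have -> : (4 / pi * odd_harmonic m - pi / 12) * pi = 4 * odd_harmonic m - pi ^+ 2 / 12.
  by move: (pi : R) p0 => P P0; field; rewrite gt_eqF.
have := odd_harmonic_le m1; have := ln2_ge.
have := pi_sqr_ge; move: lnS p1; clear.
move: (pi : R) (ln m.+1%:R) (ln m%:R) (ln 2) (odd_harmonic m) (pi ^+ 2).
move=> *; lra.
Qed.

(** Moving a negative angle by m nodes, that is by pi, makes it nonnegative. *)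
Lemma lebesgue_sum_le m a : (0 < m)%N -> `|a| <= pi ->
  lebesgue_sum m a <= 1 + 2 / pi * ln m.+1%:R.
Proof.
move=> m0 api; have [a0|a0] := leP 0 a; first exact: lebesgue_sum_le_ln.
rewrite -(lebesgue_sum_node a m m0) lebesgue_sum_le_ln//.
rewrite /node mulrC divfK ?pnatr_eq0 -?lt0n//.
by move: api; rewrite ltr0_norm//; lra.
Qed.
End InterpolationKernel.

(** * Interpolation in cosines of equidistant angles *)

Section ChebyshevInterpolation.
Variable R : realType.
Implicit Types (p q : {poly R}) (t : R) (f : R -> R).

(** Two consecutive polynomials are computed together, so that the two-step
    recurrence is structural. *)
Fixpoint chebyshev_pair (k : nat) : {poly R} * {poly R} :=
  if k is k'.+1 then
    let: (p, q) := chebyshev_pair k' in (q, 2 *: ('X * q) - p)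
  else (1, 'X).

Definition chebyshev k := (chebyshev_pair k).1.

Lemma chebyshevS2 k : chebyshev k.+2 = 2 *: ('X * chebyshev k.+1) - chebyshev k.
Proof. by rewrite /chebyshev /=; case: (chebyshev_pair k). Qed.

Lemma horner_chebyshev k t : (chebyshev k).[cos t] = cos (k%:R * t).
Proof.
have [] : (chebyshev k).[cos t] = cos (k%:R * t) /\
          (chebyshev k.+1).[cos t] = cos (k.+1%:R * t); last by [].
elim: k => [|k [IH1 IH2]].
  by rewrite /chebyshev /= hornerC hornerX mul0r cos0 mul1r.
split=> //; rewrite chebyshevS2 hornerD hornerN hornerZ hornerM hornerX IH1 IH2.
have -> : k.+2%:R * t = k.+1%:R * t + t by rewrite -[in LHS]natr1 mulrDl mul1r.
have -> : k%:R * t = k.+1%:R * t - t by rewrite -[in RHS]natr1 mulrDl mul1r addrK.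
by rewrite !cosD cosN sinN; ring.
Qed.

Lemma size_chebyshev k : (size (chebyshev k) <= k.+1)%N.
Proof.
have [] : (size (chebyshev k) <= k.+1)%N /\ (size (chebyshev k.+1) <= k.+2)%N;
  last by [].
elim: k => [|k [IH1 IH2]]; first by rewrite /chebyshev /= size_polyC oner_eq0 size_polyX.
split=> //; rewrite chebyshevS2 (leq_trans (size_polyD _ _))// geq_max size_polyN.
apply/andP; split; last by rewrite (leq_trans IH1)// ltnW.
rewrite (leq_trans (size_scale_leq _ _))// (leq_trans (size_polyMleq _ _))//.
by rewrite size_polyX.
Qed.

(** The even part in t of the kernel centred at the node of index j is a
    polynomial in cos t, with the Chebyshev polynomials in place of cosines. *)
Definition node_poly (m j : nat) : {poly R} :=
  (2 * m%:R)^-1 *: \sum_(k < m) (cos (k%:R * node R m j) *: chebyshev k +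
                                 cos (k.+1%:R * node R m j) *: chebyshev k.+1).

Lemma size_node_poly m j : (size (node_poly m j) <= m.+1)%N.
Proof.
rewrite (leq_trans (size_scale_leq _ _))//.
apply: (leq_trans (size_sum _ _ _)); apply/bigmax_leqP => k _.
rewrite (leq_trans (size_polyD _ _))// geq_max.
rewrite !(leq_trans (size_scale_leq _ _)) ?(leq_trans (size_chebyshev _))//.
  by rewrite ltnS.
by rewrite ltnS ltnW.
Qed.

Lemma horner_node_poly m j t :
  (node_poly m j).[cos t] = (dker m (t + node R m j) + dker m (- t + node R m j)) / 2.
Proof.
rewrite /node_poly /dker hornerZ horner_sum -mulrDr -big_split /= -mulrA.
congr (_ * _); rewrite mulr_suml; apply: eq_bigr => k _.
by rewrite hornerD !hornerZ !horner_chebyshev !mulrDr !mulrN !cosD !cosN !sinN; field.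
Qed.

(** The sum runs over the whole circle: an interior Lobatto point comes from two
    nodes, each contributing half of its Lagrange polynomial. *)
Definition interp_poly (m : nat) f : {poly R} :=
  \sum_(j < 2 * m) f (cos (node R m j)) *: node_poly m j.

Lemma size_interp_poly m f : (size (interp_poly m f) <= m.+1)%N.
Proof.
apply: (leq_trans (size_sum _ _ _)); apply/bigmax_leqP => j _.
exact: leq_trans (size_scale_leq _ _) (size_node_poly _ _).
Qed.

Lemma dker_nodes m i j : (i < 2 * m)%N -> (j < 2 * m)%N ->
  dker m (- node R m i + node R m j) = (i == j)%:R.
Proof.
move=> im jm; have m0 : (0 < m)%N by case: m im {jm} => //; rewrite muln0.
have node_sub a b : (a <= b)%N -> - node R m a + node R m b = node R m (b - a).
  by move=> ab; rewrite /node natrB// mulrBl addrC.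
have [ij|ij|->] := ltngtP i j; last by rewrite addNr dker0.
  by rewrite node_sub 1?ltnW// dker_node// subn_gt0 ij (leq_ltn_trans (leq_subr _ _)).
rewrite -dkerN opprD opprK addrC node_sub 1?ltnW// dker_node//.
by rewrite subn_gt0 ij (leq_ltn_trans (leq_subr _ _)).
Qed.

Lemma cos_node_mirror m i : (0 < m)%N -> (i <= 2 * m)%N ->
  cos (node R m (2 * m - i)) = cos (node R m i).
Proof.
move=> m0 im.
have -> : node R m (2 * m - i) = node R m (2 * m) - node R m i.
  by rewrite /node natrB// mulrBl.
rewrite node_2m//.
by rewrite addrC cosD2pi cosN.
Qed.

(** The kernel vanishes at all nodes but the origin, so that the two halves of
    the kernel pick out the node of index i and its mirror image 2 * m - i, which
    have the same cosine. *)
Lemma interp_polyE m f i : (0 < m)%N -> (i < 2 * m)%N ->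
  (interp_poly m f).[cos (node R m i)] = f (cos (node R m i)).
Proof.
move=> m0 im; rewrite horner_sum.
have sum1 k : (k < 2 * m)%N -> \sum_(j < 2 * m) f (cos (node R m j)) *
    dker m (- node R m k + node R m j) = f (cos (node R m k)).
  move=> km; rewrite (bigD1 (Ordinal km))//= dker_nodes// eqxx mulr1.
  rewrite big1 ?addr0// => j; rewrite -val_eqE /= => jk.
  by rewrite dker_nodes// eq_sym (negPf jk) mulr0.
have sum2 : \sum_(j < 2 * m) f (cos (node R m j)) *
    dker m (node R m i + node R m j) = f (cos (node R m i)).
  have [->|i0] := posnP i.
    rewrite -[RHS](sum1 0%N) ?muln_gt0//; apply: eq_bigr => j _.
    by rewrite /node mul0r oppr0.
  rewrite -(cos_node_mirror m0 (ltnW im)) -[RHS]sum1 ?ltn_subrL ?i0 ?muln_gt0//.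
  apply: eq_bigr => j _; rewrite -[in RHS]dker_periodic -(node_2m R m0).
  congr (_ * dker m _); rewrite /node natrB ?(ltnW im)//; ring.
rewrite (eq_bigr (fun j : 'I__ =>
    f (cos (node R m j)) * dker m (node R m i + node R m j) / 2 +
    f (cos (node R m j)) * dker m (- node R m i + node R m j) / 2)); last first.
  by move=> j _; rewrite hornerZ horner_node_poly; field.
by rewrite big_split /= -!mulr_suml sum2 sum1// -splitr.
Qed.

Lemma node_bound m i : (0 < m)%N -> (i <= m)%N -> 0 <= node R m i <= pi.
Proof.
move=> m0 im; have p0 := @pi_ge0 R.
rewrite /node mulr_ge0 ?divr_ge0//= mulrCA -[leRHS]mulr1 ler_wpM2l//.
by rewrite ler_pdivrMr ?ltr0n// mul1r ler_nat.
Qed.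

Lemma eq_poly_nodes m p q : (0 < m)%N -> (size p <= m.+1)%N -> (size q <= m.+1)%N ->
  (forall i, (i <= m)%N -> p.[cos (node R m i)] = q.[cos (node R m i)]) -> p = q.
Proof.
move=> m0 sp sq pq; apply/eqP; rewrite -subr_eq0; apply/eqP.
apply: (@roots_geq_poly_eq0 R _ [seq cos (node R m i) | i <- iota 0 m.+1]).
- apply/allP => _ /mapP[i + ->]; rewrite mem_iota add0n /= ltnS => im.
  by rewrite rootE !hornerE pq// subrr.
- rewrite map_inj_in_uniq ?iota_uniq// => i j; rewrite !mem_iota !add0n !ltnS /=.
  move=> im jm /cos_inj; rewrite !in_itv /= !node_bound// => /(_ isT isT).
  have p0 : pi / m%:R != 0 :> R by rewrite gt_eqF// divr_gt0 ?pi_gt0 ?ltr0n.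
  by move/(mulIf p0)/eqP; rewrite eqr_nat => /eqP.
- by rewrite size_map size_iota (leq_trans (size_polyD _ _))// geq_max size_polyN sp.
Qed.

(** The Lebesgue constant bounds the norm of interpolation, and p is its own
    interpolant. *)
Lemma poly_le_nodes m p e x : (0 < m)%N -> (size p <= m.+1)%N ->
  (forall i, (i <= m)%N -> `|p.[cos (node R m i)]| <= e) -> -1 <= x <= 1 ->
  `|p.[x]| <= (1 + 2 / pi * ln m.+1%:R) * e.
Proof.
move=> m0 sp pe x1; rewrite -(acosK x1); set t := acos x.
have tpi : `|t| <= pi by rewrite ger0_norm ?acos_ge0 ?acos_lepi.
have -> : p = interp_poly m (fun y => p.[y]).
  apply: (eq_poly_nodes m0) => // [|i im]; first exact: size_interp_poly.
  by rewrite interp_polyE// mul2n -addnn (leq_ltn_trans im)// -[ltnLHS]addn0 ltn_add2l.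
have pe2 j : (j < 2 * m)%N -> `|p.[cos (node R m j)]| <= e.
  move=> jm; have [|mj] := leqP j m; first exact: pe.
  by rewrite -cos_node_mirror ?(ltnW jm)// pe//; lia.
have e0 : 0 <= e by rewrite (le_trans _ (pe 0%N _)).
rewrite horner_sum (le_trans (ler_norm_sum _ _ _))//.
rewrite (@le_trans _ _ (\sum_(j < 2 * m) e * ((`|dker m (t + node R m j)|
   + `|dker m (- t + node R m j)|) / 2)))//.
  apply: ler_sum => j _; rewrite hornerZ normrM horner_node_poly normrM.
  apply: ler_pM => //; first by rewrite pe2.
  by rewrite [`|2^-1|]ger0_norm// ler_wpM2r// ler_normD.
rewrite -mulr_sumr mulrC ler_wpM2r// -mulr_suml big_split /=.
have := lebesgue_sum_le m0 tpi; have := @lebesgue_sum_le R m (- t) m0.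
rewrite normrN => /(_ tpi); rewrite /lebesgue_sum; lra.
Qed.

End ChebyshevInterpolation.

(** * Interpolation on [0, Lambda] *)

Section ChebyshevOnSegment.
Variable R : realType.
Implicit Types (p q : {poly R}) (phi : R -> R) (Lambda : R).

Lemma size_affine (a b : R) : a != 0 -> size (b%:P + a *: 'X) = 2.
Proof.
move=> a0; rewrite addrC size_polyDl size_scale// size_polyX// ltnS.
exact: size_polyC_leq1.
Qed.

Lemma lobatto_pointE Lambda m j :
  lobatto_point Lambda m j = Lambda / 2 * (1 - cos (node R m j)).
Proof. by rewrite /lobatto_point /node mulrCA mulrA. Qed.

Lemma cheb_polyP phi Lambda m : 0 < Lambda -> (0 < m)%N ->
  (size (cheb_poly phi Lambda m) <= m.+1)%N /\
  forall j, (j <= m)%N -> (cheb_poly phi Lambda m).[lobatto_point Lambda m j]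
                          = phi (lobatto_point Lambda m j).
Proof.
move=> L0 m0; rewrite /cheb_poly; set S := (X in xget _ X).
suff : exists p, S p by move=> ex; exact: (xgetPex 0 ex).
exists (interp_poly m (fun y => phi (Lambda / 2 * (1 - y)))
        \Po (1%:P + (- (2 / Lambda)) *: 'X)).
split.
  rewrite size_comp_poly2 ?size_interp_poly// size_affine// oppr_eq0 gt_eqF//.
  by rewrite divr_gt0.
move=> j jm; rewrite horner_comp lobatto_pointE hornerD hornerC hornerZ hornerX.
have -> : 1 + - (2 / Lambda) * (Lambda / 2 * (1 - cos (node R m j))) = cos (node R m j).
  by field; rewrite gt_eqF.
by rewrite interp_polyE//; lia.
Qed.

(** The interpolant c differs from p by a polynomial that is bounded by e at the
    interpolation points, because c agrees with phi there. *)
Lemma cheb_poly_error phi Lambda m p e : 0 < Lambda -> (0 < m)%N ->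
  (size p <= m.+1)%N -> (forall x, 0 <= x <= Lambda -> `|phi x - p.[x]| <= e) ->
  forall x, 0 <= x <= Lambda ->
  `|phi x - (cheb_poly phi Lambda m).[x]| <= (2 + 2 / pi * ln m.+1%:R) * e.
Proof.
move=> L0 m0 sp pe x x0L; have [sc cE] := cheb_polyP phi L0 m0.
set c := cheb_poly phi Lambda m in sc cE *.
pose d := (c - p) \Po ((Lambda / 2)%:P + (- (Lambda / 2)) *: 'X).
have dE y : d.[y] = (c - p).[Lambda / 2 * (1 - y)].
  by rewrite horner_comp; congr (_.[_]); rewrite hornerD hornerC hornerZ hornerX; ring.
have sd : (size d <= m.+1)%N.
  rewrite size_comp_poly2 ?size_affine ?oppr_eq0 ?mulf_neq0 ?gt_eqF//.
  by rewrite (leq_trans (size_polyD _ _))// geq_max size_polyN sc.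
have de i : (i <= m)%N -> `|d.[cos (node R m i)]| <= e.
  move=> im; rewrite dE -lobatto_pointE hornerD hornerN cE// pe//.
  rewrite lobatto_pointE; have := cos_le1 (node R m i); have := cos_geN1 (node R m i).
  move: (cos _) => y y1 y2; apply/andP; split.
    by rewrite mulr_ge0 ?divr_ge0 ?(ltW L0)//; lra.
  rewrite -subr_ge0 (_ : _ - _ = Lambda / 2 * (1 + y)); last by field.
  by rewrite mulr_ge0 ?divr_ge0 ?(ltW L0)//; lra.
have := @poly_le_nodes R m d e (1 - 2 / Lambda * x) m0 sd de.
rewrite dE (_ : Lambda / 2 * _ = x); last by field; rewrite gt_eqF.
move=> /(_ _)/wrap[|cpe].
  move: x0L => /andP[x0 xL]; have : 0 <= x / Lambda by rewrite divr_ge0// ltW.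
  have : x / Lambda <= 1 by rewrite ler_pdivrMr// mul1r.
  by rewrite mulrAC -mulrA; move: (x / Lambda) => u; lra.
have -> : phi x - c.[x] = (phi x - p.[x]) - (c - p).[x] by rewrite hornerD hornerN; ring.
rewrite (le_trans (ler_normB _ _))//.
have := pe x x0L; move: cpe; move: `|_| `|_| (_ * ln _) => A B l; lra.
Qed.
End ChebyshevOnSegment.

(** * Orthogonal diagonalization of real symmetric matrices *)

Section SpectralTheorem.
Variable R : realType.

(** Over the complex numbers A is Hermitian; its eigenvalues there are real, and
    an eigenvalue in a subfield is one over that subfield. *)
Lemma symmetric_eigenvalue n (A : 'M[R]_n.+1) : A^T = A -> exists a, eigenvalue A a.
Proof.
move=> Asym; pose toC := real_complex R.
pose Ac := map_mx toC A.
have Ach : Ac \is hermsymmx.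
  apply: realsym_hermsym.
    by apply/is_hermitianmxP; rewrite expr0 scale1r map_mx_id// /Ac map_trmx Asym.
  by apply/mxOverP => i j; rewrite mxE; apply/complex_realP; exists (A i j).
have /hermitian_normalmx/orthomx_spectralP AcE := Ach.
have /mxOverP/(_ 0 0)/complex_realP[a aE] := hermitian_spectral_diag_real Ach.
set P := spectralmx Ac in AcE; have Pu : P \in unitmx by apply: spectral_unit.
exists a; rewrite -(eigenvalue_map toC); apply/eigenvalueP; exists (row 0 P).
  rewrite -/Ac {1}AcE mulmxA mulmxA -row_mul mulmxV// row1.
  by rewrite -rowE row_diag_mx aE -scalemxAl -rowE.
apply/eqP; rewrite rowE => /(congr1 (mulmx^~ (invmx P))).
rewrite mulmxK// mul0mx => /matrixP/(_ 0 0)/eqP.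
by rewrite !mxE !eqxx oner_eq0.
Qed.

Definition orthogonalmx n (U : 'M[R]_n) : Prop := U^T *m U = 1%:M.

Lemma mulmx_tr_orthogonal n (U : 'M[R]_n) : orthogonalmx U -> U *m U^T = 1%:M.
Proof. exact: mulmx1C. Qed.

(** The Householder reflection that exchanges u and the first canonical vector, or
    the identity if they agree. *)
Lemma orthogonal_first_column n (u : 'cV[R]_n.+1) : u^T *m u = 1%:M ->
  exists2 U, orthogonalmx U & U *m delta_mx 0 0 = u.
Proof.
move=> u1; pose e : 'cV[R]_n.+1 := delta_mx 0 0.
have [->|ue] := eqVneq u e.
  by exists 1%:M; rewrite ?mul1mx// /orthogonalmx trmx1 mul1mx.
pose w := u - e; pose s := 2 - 2 * u 0 0.
have e1 : e^T *m e = 1%:M.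
  rewrite /e trmx_delta mul_delta_mx; apply/matrixP => i j.
  by rewrite (ord1 i) (ord1 j) !mxE.
have ue0 : u^T *m e = (u 0 0)%:M.
  rewrite [u^T *m e]mx11_scalar mxE (bigD1 0)//= big1.
    by rewrite addr0 !mxE mulr1.
  by move=> i i0; rewrite !mxE (negPf i0) mulr0.
have eu0 : e^T *m u = (u 0 0)%:M.
  by rewrite -[e^T *m u]trmxK trmx_mul trmxK ue0 tr_scalar_mx.
have ws : w^T *m w = s%:M.
  rewrite /w [(u - e)^T]linearB /= mulmxBl !mulmxBr u1 e1 ue0 eu0.
  by apply/matrixP => i j; rewrite (ord1 i) (ord1 j) !mxE !eqxx !mulr1n /s; ring.
have s0 : s != 0.
  apply: contraNneq ue => s0; rewrite -subr_eq0 -/w.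
  have := congr1 (fun X : 'M[R]_1 => X 0 0) ws; rewrite s0 !mxE eqxx mul0rn => /eqP.
  under eq_bigr do rewrite mxE -expr2.
  rewrite psumr_eq0; last by move=> i _; exact: sqr_ge0.
  move=> /allP w0; apply/eqP/matrixP => i j; rewrite (ord1 j) [RHS]mxE.
  by apply/eqP; have := w0 i (mem_index_enum _); rewrite /= sqrf_eq0.
exists (1%:M - (2 / s) *: (w *m w^T)).
  have WT : (w *m w^T)^T = w *m w^T by rewrite trmx_mul trmxK.
  have WW : w *m w^T *m (w *m w^T) = s *: (w *m w^T).
    by rewrite mulmxA -(mulmxA w) ws mul_mx_scalar -scalemxAl.
  rewrite /orthogonalmx [(_ - _)^T]linearB /= trmx1 [(_ *: _)^T]linearZ /= WT.
  rewrite mulmxBl mul1mx mulmxBr mulmx1 -scalemxAl -scalemxAr WW.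
  move: (w *m w^T) => W; apply/matrixP => i j; rewrite !mxE; by field.
rewrite mulmxBl mul1mx -scalemxAl -mulmxA -/e.
have -> : w^T *m e = (- (s / 2))%:M.
  rewrite /w [(u - e)^T]linearB /= mulmxBl ue0 e1.
  by apply/matrixP => i j; rewrite (ord1 i) (ord1 j) !mxE !eqxx !mulr1n /s; field.
rewrite mul_mx_scalar scalerA.
have -> : 2 / s * - (s / 2) = -1 by field.
by rewrite scaleN1r opprK /w addrC subrK.
Qed.

(** Deflation: in an orthonormal basis that starts with an eigenvector, the matrix
    is block diagonal with a symmetric block of smaller size. *)
Theorem symmetric_diagonalization n (A : 'M[R]_n) : A^T = A ->
  exists U d, orthogonalmx U /\ A = U *m diag_mx d *m U^T.
Proof.
elim: n A => [|n IHn] A Asym.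
  by exists 1%:M, 0; split; [rewrite /orthogonalmx trmx1 mul1mx | apply/matrixP => -[]].
have [a /eigenvalueP[v vA v0]] := symmetric_eigenvalue Asym.
pose r := \sum_j v 0 j ^+ 2.
have r0 : 0 < r.
  rewrite lt0r sumr_ge0 ?andbT; last by move=> j _; exact: sqr_ge0.
  apply: contraNneq v0 => /eqP; rewrite psumr_eq0; last by move=> j _; exact: sqr_ge0.
  move=> /allP w0; apply/eqP/matrixP => i j; rewrite (ord1 i) [RHS]mxE.
  by apply/eqP; have := w0 j (mem_index_enum _); rewrite /= sqrf_eq0.
pose u : 'cV[R]_n.+1 := (Num.sqrt r)^-1 *: v^T.
have u1 : u^T *m u = 1%:M.
  rewrite /u [(_ *: v^T)^T]linearZ /= trmxK -scalemxAl -scalemxAr scalerA.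
  have -> : v *m v^T = r%:M.
    rewrite [v *m v^T]mx11_scalar mxE; congr _%:M.
    by apply: eq_bigr => j _; rewrite mxE -expr2.
  rewrite scale_scalar_mx -invfM -expr2 sqr_sqrtr ?(ltW r0)//.
  by rewrite mulVf// gt_eqF.
have Au : A *m u = a *: u.
  by rewrite /u -scalemxAr -[A]Asym -trmx_mul vA [(a *: v)^T]linearZ /= !scalerA mulrC.
have [H Ho He] := orthogonal_first_column u1.
have Ho' := mulmx_tr_orthogonal Ho.
(* A in an orthonormal basis whose first vector is the eigenvector u. *)
pose B : 'M[R]_(1 + n) := H^T *m A *m H.
have Bsym : B^T = B by rewrite /B !trmx_mul trmxK Asym mulmxA.
have Be : B *m (delta_mx 0 0 : 'cV[R]_(1 + n)) = a *: delta_mx 0 0.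
  by rewrite /B -!mulmxA He Au -scalemxAr -He mulmxA Ho mul1mx.
have AE : A = H *m B *m H^T.
  by rewrite /B !mulmxA Ho' mul1mx -mulmxA Ho' mulmx1.
move: B Bsym Be AE => B Bsym Be AE.
have Bdl : dlsubmx B = 0.
  apply/matrixP => i j; rewrite (ord1 j) !mxE.
  have /matrixP/(_ (rshift 1 i) 0) := Be; rewrite -colE !mxE.
  rewrite (_ : lshift n 0 = 0 :> 'I_(1 + n)); last exact: val_inj.
  by move=> ->; rewrite mulr0.
have BE : B = block_mx (ulsubmx B) 0 0 (drsubmx B).
  by rewrite -[LHS]submxK Bdl -[ursubmx B]trmxK trmx_ursub Bsym Bdl trmx0.
have [|U [d [Uo dE]]] := IHn (drsubmx B); first by rewrite trmx_drsub Bsym.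
pose C : 'M[R]_(1 + n) := block_mx 1%:M 0 0 U.
pose c : 'rV[R]_(1 + n) := row_mx (ulsubmx B) d.
have Co : orthogonalmx C.
  rewrite /orthogonalmx tr_block_mx mulmx_block !trmx0 !trmx1 !(mulmx0, mul0mx, mulmx1).
  by rewrite Uo !addr0 add0r -scalar_mx_block.
have BC : B = C *m diag_mx c *m C^T.
  rewrite [LHS]BE diag_mx_row tr_block_mx !mulmx_block !trmx0 !trmx1.
  rewrite !(mulmx0, mul0mx, mulmx1, mul1mx, addr0, add0r) -dE.
  congr block_mx; apply/matrixP => i j.
  by rewrite (ord1 i) (ord1 j) !mxE eqxx mulr1n.
exists (H *m (C : 'M[R]_n.+1)), (c : 'rV[R]_n.+1); split.
  rewrite /orthogonalmx trmx_mul mulmxA -(mulmxA _ _ H) Ho mulmx1; exact: Co.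
rewrite AE {1}BC trmx_mul !mulmxA; reflexivity.
Qed.
End SpectralTheorem.

(** * Matrix functions and the Krylov error estimate *)

Section MatrixFunctions.
Variable R : realType.
Implicit Types (phi psi : R -> R) (Lambda e : R).

(** The squared norm, which is quadratic in the entries and free of roots. *)
Definition frobenius2 m n (A : 'M[R]_(m, n)) : R := \sum_i \sum_j A i j ^+ 2.

Lemma frobenius2_ge0 m n (A : 'M[R]_(m, n)) : 0 <= frobenius2 A.
Proof. by apply: sumr_ge0 => i _; apply: sumr_ge0 => j _; exact: sqr_ge0. Qed.

Lemma frobenius_ge0 m n (A : 'M[R]_(m, n)) : 0 <= frobenius A.
Proof. exact: sqrtr_ge0. Qed.

Lemma sqr_frobenius m n (A : 'M[R]_(m, n)) : frobenius A ^+ 2 = frobenius2 A.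
Proof. by rewrite sqr_sqrtr ?frobenius2_ge0. Qed.

Lemma frobenius2_tr m n (A : 'M[R]_(m, n)) : frobenius2 A = \tr (A^T *m A).
Proof.
rewrite /frobenius2 exchange_big; apply: eq_bigr => j _ /=.
by rewrite mxE; apply: eq_bigr => i _; rewrite mxE -expr2.
Qed.

Lemma frobenius_le m n (A : 'M[R]_(m, n)) e : 0 <= e ->
  (frobenius A <= e) = (frobenius2 A <= e ^+ 2).
Proof.
by move=> e0; rewrite -sqr_frobenius ler_pXn2r ?nnegrE ?frobenius_ge0.
Qed.

Lemma frobeniusZ m n c (A : 'M[R]_(m, n)) : frobenius (c *: A) = `|c| * frobenius A.
Proof.
rewrite /frobenius -sqrtr_sqr -sqrtrM ?sqr_ge0// mulr_sumr; congr Num.sqrt.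
by apply: eq_bigr => i _; rewrite mulr_sumr; apply: eq_bigr => j _; rewrite mxE exprMn.
Qed.

(** The parallelogram law replaces the triangle inequality: both terms have the
    same bound. *)
Lemma frobenius_sub_le m n (A B : 'M[R]_(m, n)) e :
  frobenius A <= e -> frobenius B <= e -> frobenius (A - B) <= 2 * e.
Proof.
move=> Ae Be; have e0 : 0 <= e := le_trans (frobenius_ge0 A) Ae.
move: Ae Be; rewrite !frobenius_le ?mulr_ge0// => Ae Be.
have : frobenius2 (A - B) <= 2 * frobenius2 A + 2 * frobenius2 B.
  rewrite /frobenius2 !mulr_sumr -big_split /=; apply: ler_sum => i _.
  rewrite !mulr_sumr -big_split /=; apply: ler_sum => j _; rewrite !mxE.
  rewrite -subr_ge0 (_ : _ - _ = (A i j + B i j) ^+ 2) ?sqr_ge0//; by ring.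
by rewrite exprMn; lra.
Qed.

Lemma frobenius2_orthogonal m n (U : 'M[R]_m) (A : 'M[R]_(m, n)) :
  orthogonalmx U -> frobenius2 (U *m A) = frobenius2 A.
Proof.
by move=> Uo; rewrite !frobenius2_tr trmx_mul mulmxA -(mulmxA A^T) Uo mulmx1.
Qed.

(** One decomposition serves all functions phi. *)
Lemma matfunE n (A : 'M[R]_n) : A^T = A -> exists U d,
  [/\ orthogonalmx U, A = U *m diag_mx d *m U^T &
      forall phi, matfun phi A = U *m diag_mx (map_mx phi d) *m U^T].
Proof.
move=> Asym; have [U [d [Uo AE]]] := symmetric_diagonalization Asym.
have [] : spectral_decompositions A (xget (1%:M, 0) (spectral_decompositions A)).
  by apply: xgetPex; exists (U, d).
by rewrite /matfun; case: (xget _ _) => U' d' /= Uo' AE'; exists U', d'.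
Qed.

Lemma matfunB n (A : 'M[R]_n) phi psi : A^T = A ->
  matfun (fun x => phi x - psi x) A = matfun phi A - matfun psi A.
Proof.
move=> /matfunE[U [d [_ _ fE]]]; rewrite !fE -mulmxBl -mulmxBr; congr (_ *m _ *m _).
by apply/matrixP => i j; rewrite !mxE -mulrnBl.
Qed.

Lemma matfun_horner n (A : 'M[R]_n) (p : {poly R}) : A^T = A ->
  matfun (fun x => p.[x]) A = \sum_(k < size p) p`_k *: (A ^+ k).
Proof.
move=> /matfunE[U [d [Uo AE fE]]]; rewrite fE.
have powE k : A ^+ k = U *m diag_mx (map_mx (fun x => x ^+ k) d) *m U^T.
  elim: k => [|k IHk].
    rewrite expr0 (_ : map_mx _ d = const_mx 1) ?diag_const_mx.
      by rewrite mulmx1 mulmx_tr_orthogonal.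
    by apply/matrixP => i j; rewrite !mxE.
  rewrite exprS IHk [A in A * _]AE -!mulmxE -!mulmxA; congr (_ *m _).
  rewrite !mulmxA -(mulmxA (diag_mx d)) Uo mulmx1 mulmx_diag; congr (diag_mx _ *m _).
  by apply/matrixP => i j; rewrite !mxE (ord1 i) exprS.
under eq_bigr do rewrite powE scalemxAl scalemxAr.
rewrite -mulmx_suml -mulmx_sumr; congr (_ *m _ *m _).
apply/matrixP => i j; rewrite summxE !mxE horner_coef.
rewrite -sumrMnl; apply: eq_bigr => k _; rewrite !mxE.
by rewrite mulrnAr.
Qed.

(** The spectrum of a symmetric matrix lies in [0, Lambda], expressed by
    Rayleigh quotients: this form passes to compressions. *)
Definition rayleigh_in Lambda n (A : 'M[R]_n) : Prop :=
  forall x : 'cV[R]_n, 0 <= \tr (x^T *m (A *m x)) <= Lambda * \tr (x^T *m x).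

Lemma spectrum_rayleigh_in Lambda n (A : 'M[R]_n) : A^T = A ->
  (forall a, eigenvalue A a -> 0 <= a <= Lambda) -> rayleigh_in Lambda A.
Proof.
move=> /matfunE[U [d [Uo AE _]]] spec x.
have dL i : 0 <= d 0 i <= Lambda.
  apply: spec; apply/eigenvalueP; exists (row i U^T).
    rewrite AE -row_mul !mulmxA Uo mul1mx row_mul row_diag_mx -scalemxAl.
    by rewrite -rowE.
  apply/eqP; rewrite rowE => /(congr1 (mulmx^~ U)); rewrite -mulmxA Uo mulmx1 mul0mx.
  by move=> /matrixP/(_ 0 i)/eqP; rewrite !mxE !eqxx oner_eq0.
pose y := U^T *m x.
have -> : x^T *m (A *m x) = y^T *m (diag_mx d *m y).
  by rewrite AE /y trmx_mul trmxK !mulmxA.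
have -> : x^T *m x = y^T *m y.
  by rewrite /y trmx_mul trmxK mulmxA -(mulmxA _ U) mulmx_tr_orthogonal// mulmx1.
have trE B : \tr (y^T *m B) = \sum_i y i 0 * B i 0.
  by rewrite /mxtrace big_ord1 mxE; apply: eq_bigr => i _; rewrite mxE.
rewrite !trE mulr_sumr; apply/andP; split.
  apply: sumr_ge0 => i _; rewrite mul_diag_mx mxE mulrCA -expr2.
  by rewrite mulr_ge0 ?sqr_ge0//; case/andP: (dL i).
apply: ler_sum => i _; rewrite mul_diag_mx mxE mulrCA -expr2.
by rewrite ler_wpM2r ?sqr_ge0//; case/andP: (dL i).
Qed.

(** In an orthonormal eigenbasis psi (A) multiplies the coordinates by the values
    of psi on the spectrum, and the norm does not depend on the basis. *)
Lemma matfun_mul_le Lambda n N (A : 'M[R]_n) (B : 'M[R]_(n, N)) psi e :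
  A^T = A -> rayleigh_in Lambda A -> 0 <= e ->
  (forall x, 0 <= x <= Lambda -> `|psi x| <= e) ->
  frobenius (matfun psi A *m B) <= e * frobenius B.
Proof.
move=> /matfunE[U [d [Uo AE ->]]] AL e0 psie.
have dL i : 0 <= d 0 i <= Lambda.
  pose ei : 'cV[R]_n := delta_mx i 0.
  have trE (x : R) : \tr (ei^T *m (x *: ei)) = x.
    rewrite -scalemxAr linearZ /= trmx_delta mul_delta_mx.
    by rewrite /mxtrace big_ord1 mxE !eqxx mulr1.
  have := AL (U *m ei); rewrite AE trmx_mul -!mulmxA (mulmxA _ U) Uo mul1mx.
  rewrite (mulmxA _ U ei) Uo mul1mx.
  have -> : diag_mx d *m ei = d 0 i *: ei.
    apply/matrixP => k l; rewrite mul_diag_mx !mxE.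
    by case: (k =P i) => [->//|_]; rewrite !mulr0.
  by rewrite -[in X in _ * \tr (_ *m X)](scale1r ei) !trE mulr1.
rewrite frobenius_le ?mulr_ge0 ?frobenius_ge0// exprMn sqr_frobenius.
rewrite -!mulmxA frobenius2_orthogonal//.
rewrite -[leRHS](_ : e ^+ 2 * frobenius2 (U^T *m B) = _); last first.
  by rewrite frobenius2_orthogonal// /orthogonalmx trmxK mulmx_tr_orthogonal.
move: (U^T *m B) => Y; rewrite mul_diag_mx /frobenius2 mulr_sumr.
apply: ler_sum => i _; rewrite mulr_sumr; apply: ler_sum => j _.
rewrite !mxE exprMn ler_wpM2r ?sqr_ge0// -[leLHS]real_normK ?num_real//.
by rewrite ler_pXn2r ?nnegrE ?psie.
Qed.

(** For the polynomial p in place of phi both terms agree, because V intertwines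
    the powers of H and L on B. Only phi - p contributes to the difference, and
    it is bounded by e on the spectrum of L as well as on that of H. *)
Lemma krylov_error n N d q (L : 'M[R]_n) (H : 'M[R]_d)
    (V : {linear 'M[R]_(d, q) -> 'M[R]_(n, N)}) (B : 'M[R]_(d, q))
    Lambda phi (m : nat) (p : {poly R}) e :
  L^T = L -> rayleigh_in Lambda L -> H^T = H -> rayleigh_in Lambda H ->
  (forall X, frobenius (V X) = frobenius X) ->
  (forall k, (k <= m)%N -> V (H ^+ k *m B) = L ^+ k *m V B) ->
  (size p <= m.+1)%N -> 0 <= e ->
  (forall x, 0 <= x <= Lambda -> `|phi x - p.[x]| <= e) ->
  frobenius (matfun phi L *m V B - V (matfun phi H *m B)) <= 2 * (e * frobenius B).
Proof.
move=> Lsym LL Hsym HL Viso VH sp e0 pe.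
have pE : V (matfun (fun x => p.[x]) H *m B) = matfun (fun x => p.[x]) L *m V B.
  rewrite !matfun_horner// !mulmx_suml linear_sum; apply: eq_bigr => k _ /=.
  by rewrite -!scalemxAl linearZ /= VH// -ltnS (leq_trans _ sp).
have -> : matfun phi L *m V B - V (matfun phi H *m B) =
    matfun (fun x => phi x - p.[x]) L *m V B
    - V (matfun (fun x => phi x - p.[x]) H *m B).
  by rewrite !matfunB// !mulmxBl linearB /= pE opprB addrA subrK.
apply: frobenius_sub_le; last by rewrite Viso (matfun_mul_le B Hsym HL).
by rewrite -[frobenius B]Viso (matfun_mul_le (V B) Lsym LL).
Qed.
End MatrixFunctions.

Section KrylovPowers.
Variable R : realType.

(** The powers H ^ k B with k <= m vanish above level k, hence the relation
    L V = V H, which fails at the last level m only, can be iterated. *)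
Lemma krylov_powers n N d q (L : 'M[R]_n) (H : 'M[R]_d)
    (V : 'M[R]_(d, q) -> 'M[R]_(n, N)) (B : 'M[R]_(d, q))
    (level : 'I_d -> nat) (m : nat) :
  (forall i j, ((level j).+1 < level i)%N -> H i j = 0) ->
  (forall i c, (0 < level i)%N -> B i c = 0) ->
  (forall y : 'M[R]_(d, q), (forall i c, (m <= level i)%N -> y i c = 0) ->
     L *m V y = V (H *m y)) ->
  forall k, (k <= m)%N -> V (H ^+ k *m B) = L ^+ k *m V B.
Proof.
move=> Hband B0 LV.
have supp k i c : (k < level i)%N -> (H ^+ k *m B) i c = 0.
  elim: k i => [|k IHk] i ki; first by rewrite expr0 mul1mx B0.
  rewrite exprS -mulmxE -mulmxA mxE big1// => j _.
  have [jk|kj] := leqP (level j) k; last by rewrite IHk// mulr0.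
  by rewrite Hband ?mul0r// (leq_ltn_trans _ ki).
elim=> [|k IHk] km; first by rewrite !expr0 !mul1mx.
rewrite !exprS -!mulmxE -!mulmxA -IHk ?(ltnW km)// LV// => i c mi.
by rewrite supp// (leq_trans km).
Qed.

(** The traces are sums over the columns of X. *)
Lemma rayleigh_in_mx Lambda n N (A : 'M[R]_n) (X : 'M[R]_(n, N)) :
  rayleigh_in Lambda A ->
  0 <= \tr (X^T *m (A *m X)) <= Lambda * \tr (X^T *m X).
Proof.
move=> AL.
have trcol (Y : 'M[R]_(n, N)) :
    \tr (X^T *m Y) = \sum_j \tr ((col j X)^T *m col j Y).
  apply: eq_bigr => j _; rewrite /mxtrace big_ord1 !mxE.
  by apply: eq_bigr => i _; rewrite !mxE.
have colM j : col j (A *m X) = A *m col j X by rewrite !colE mulmxA.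
rewrite !trcol; apply/andP; split.
  by apply: sumr_ge0 => j _; rewrite colM; case/andP: (AL (col j X)).
rewrite mulr_sumr; apply: ler_sum => j _.
by rewrite colM; case/andP: (AL (col j X)).
Qed.
End KrylovPowers.

(** * The Lanczos recurrence with coefficients in a ring *)

(** Coefficients act on the right and need not commute: they are scalars for
    the global and the ordinary method, N x N matrices for the block method. *)
Record inner_product_axioms (S : pzRingType) (V : zmodType) (star : S -> S)
    (act : V -> S -> V) (ip : V -> V -> S) (op : V -> V) : Prop :=
  InnerProductAxioms {
    star0 : star 0 = 0;
    ipBr : forall a b c, ip a (b - c) = ip a b - ip a c;
    ip_act : forall a b s, ip a (act b s) = ip a b * s;
    ip_star : forall a b, star (ip a b) = ip b a;
    ip_op : forall a b, ip (op a) b = ip a (op b);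
    act0r : forall a, act a 0 = 0;
    act0l : forall s, act 0 s = 0 }.

Section AbstractLanczos.
Variables (S : pzRingType) (V : zmodType).
Variables (star : S -> S) (act : V -> S -> V) (ip : V -> V -> S) (op : V -> V).
Hypothesis axioms : inner_product_axioms star act ip op.

Variables (M : nat) (Q : nat -> V) (H : nat -> nat -> S).

Definition lanczos_recurrence : Prop :=
  [/\ Q 0%N = 0, ip (Q 1%N) (Q 1%N) = 1 &
    forall k, (0 < k <= M)%N ->
      let X := op (Q k) - act (Q k.-1) (H k.-1 k) in
      H k k = ip (Q k) X /\
      ((k < M)%N ->
        [/\ X - act (Q k) (H k k) = act (Q k.+1) (H k.+1 k),
            ip (Q k.+1) (Q k.+1) = 1,
            H k k.+1 = star (H k.+1 k) &
            exists s, H k.+1 k * s = 1])].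

Hypothesis run : lanczos_recurrence.

Definition banded i j : S := if (i <= j.+1)%N && (j <= i.+1)%N then H i j else 0.

Let ip0r a : ip a 0 = 0.
Proof. by rewrite -(subrr 0) (ipBr axioms) subrr. Qed.

Let ipDr a b c : ip a (b + c) = ip a b + ip a c.
Proof. by rewrite -{1}[c]opprK -[- c]sub0r !(ipBr axioms) ip0r opprB addrC subr0 addrC. Qed.

Let Q0 : Q 0%N = 0. Proof. by case: run. Qed.

Let ip0l a : ip (Q 0%N) a = 0.
Proof. by rewrite Q0 -(ip_star axioms) ip0r (star0 axioms). Qed.

Lemma lanczos_three_term k : (0 < k < M)%N ->
  op (Q k) = act (Q k.-1) (H k.-1 k) + act (Q k) (H k k) + act (Q k.+1) (H k.+1 k).
Proof.
case/andP=> k0 kM; have [_ _ /(_ k)] := run; rewrite k0 (ltnW kM).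
case=> // _ /(_ kM)[<- _ _ _].
by rewrite -addrA [X in _ + X]addrC subrK addrC subrK.
Qed.

(** Against Q k the new vector is orthogonal by the choice of H k k. Against an
    earlier Q l, symmetry moves op to Q l, which by its own recurrence meets Q k
    only if l + 1 = k; that one term is cancelled by the
    multiple of Q k.-1 in the recurrence. *)
Lemma lanczos_orthonormal i j : (i <= M)%N -> (j <= M)%N ->
  ip (Q i) (Q j) = ((i == j) && (0 < i)%N)%:R.
Proof.
have [_ Q1 step] := run.
suff ortho K : (K <= M)%N -> forall i j, (i <= K)%N -> (j <= K)%N ->
    ip (Q i) (Q j) = ((i == j) && (0 < i)%N)%:R by exact: ortho.
elim: K => [|K IHK] KM {}i {}j.
  by rewrite !leqn0 => /eqP-> /eqP->; rewrite ip0l.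
have {}IHK := IHK (ltnW KM).
have QS : ip (Q K.+1) (Q K.+1) = 1.
  case: K KM {IHK} => // K KM.
  by have [|_ /(_ KM)[_ -> _ _]] := step K.+1; first exact: ltnW.
have QK l : (l <= K)%N -> ip (Q l) (Q K.+1) = 0.
  case: l => [|l lK]; first by rewrite ip0l.
  have K0 : (0 < K)%N by apply: leq_trans lK.
  have [|HKK /(_ KM)[QE _ HK [s Hs]]] := step K; first by rewrite K0 ltnW.
  rewrite -[LHS]mulr1 -Hs mulrA -(ip_act axioms) -QE -[RHS](mul0r s); congr (_ * s).
  rewrite (ipBr axioms) (ip_act axioms); have [->|lneK] := eqVneq l.+1 K.
    by rewrite IHK// eqxx K0 mul1r -HKK subrr.
  rewrite [ip (Q l.+1) (Q K)]IHK// (negPf lneK) mul0r subr0 (ipBr axioms) (ip_act axioms).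
  rewrite -(ip_op axioms) -(ip_star axioms).
  have {}lK : (l.+1 < K)%N by rewrite ltn_neqAle lneK.
  have lM : (0 < l.+1 < M)%N by rewrite (ltn_trans lK).
  have lK' := ltnW lK; have lK'' := ltnW lK'.
  have -> : ip (Q K) (op (Q l.+1)) = (K == l.+2)%:R * H l.+2 l.+1.
    rewrite lanczos_three_term//= !ipDr !(ip_act axioms) !IHK//.
    by rewrite K0 !andbT (gtn_eqF lK) (gtn_eqF lK') !mul0r !add0r.
  rewrite IHK ?leq_pred// andbT; have [KE|KneE] := eqVneq K l.+2.
    rewrite KE /= eqxx !mul1r; case/andP: lM => _ lM.
    by have [|_ /(_ lM)[_ _ -> _]] := step l.+1; [exact: ltnW | rewrite subrr].
  rewrite mul0r (star0 axioms) (_ : _ == _ = false) ?mul0r ?subrr//.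
  by apply/eqP => e; move/eqP: KneE; apply; rewrite e prednK.
move: i j => [|i] [|j]; rewrite ?leqnn ?ip0l//=.
- by move=> _ _; rewrite -(ip_star axioms) ip0l (star0 axioms).
rewrite leq_eqVlt => /predU1P[[->]|iK]; rewrite leq_eqVlt => /predU1P[[->]|jK].
- by rewrite QS eqxx.
- by rewrite -(ip_star axioms) QK// (star0 axioms) gtn_eqF.
- by rewrite QK// ltn_eqF.
- exact: IHK.
Qed.

Lemma sum_delta_nat (c : nat) (F : nat -> V) : (c < M)%N ->
  \sum_(i < M) (if (i : nat) == c then F i else 0) = F c.
Proof.
move=> cM; rewrite (bigD1 (Ordinal cM))//= eqxx big1 ?addr0// => i.
by rewrite -val_eqE /= => /negPf->.
Qed.

(** The three-term recurrence as a column of a matrix relation. The last basis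
    element is excluded, since its image leaves the span of the basis. *)
Lemma lanczos_column j : (0 < j < M)%N ->
  op (Q j) = \sum_(i < M) act (Q i.+1) (banded i.+1 j).
Proof.
move=> jM; rewrite lanczos_three_term//; case: j jM => // j /= jM.
pose T i := act (Q i.+1) (H i.+1 j.+1).
rewrite (eq_bigr (fun i : 'I_M => (if i.+1 == j :> nat then T i else 0)
   + (if i == j :> nat then T i else 0) + (if i == j.+1 :> nat then T i else 0))).
  rewrite !big_split /= !sum_delta_nat ?(ltnW jM)//; congr (_ + _ + _).
  case: j jM @T => [|j] jM T; last by rewrite sum_delta_nat// (ltn_trans _ jM).
  by rewrite Q0 (act0l axioms) big1.
move=> i _; rewrite /banded !ltnS (fun_if (act (Q i.+1))) (act0r axioms) -/(T i).
have [ij|ij] := eqVneq (i : nat) j.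
  by rewrite ij leqnSn gtn_eqF// ltn_eqF//= addr0 add0r.
have [ij'|ij'] := eqVneq i.+1 j.
  by rewrite -ij' leqnn !ltn_eqF ?addr0//; case: leqP => //; lia.
have [ij2|ij2] := eqVneq (i : nat) j.+1.
  by rewrite ij2 leqnn /= !add0r; case: leqP => //; lia.
by rewrite !addr0; case: andP => // -[]; lia.
Qed.

(** The banded matrix is the compression of op to the span of the basis. Its last
    column is obtained from the symmetry of op, for lack of a recurrence. *)
Lemma lanczos_entry i j : (0 < i <= M)%N -> (0 < j <= M)%N ->
  ip (Q i) (op (Q j)) = banded i j.
Proof.
have [_ _ step] := run.
have hlow k l : (0 < k <= M)%N -> (0 < l < M)%N -> ip (Q k) (op (Q l)) = banded k l.
  move=> /andP[k0 kM] /andP[l0 lM].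
  have -> : ip (Q k) (op (Q l)) =
      (k == l.-1)%:R * H l.-1 l + (k == l)%:R * H l l + (k == l.+1)%:R * H l.+1 l.
    rewrite lanczos_three_term ?l0// !ipDr !(ip_act axioms) !lanczos_orthonormal ?k0 ?andbT//.
    - exact: ltnW.
    - exact: leq_trans (leq_pred _) (ltnW lM).
  case: l l0 lM => // l _ lM; rewrite /banded /=.
  have [->|kl] := eqVneq k l.+1.
    by rewrite leqnSn gtn_eqF// ltn_eqF// !mul0r mul1r add0r addr0.
  have [->|kl'] := eqVneq k l.
    by rewrite leqnn ltn_eqF ?mul0r ?mul1r ?addr0//; case: leqP => //; lia.
  have [->|kl2] := eqVneq k l.+2.
    by rewrite leqnn !mul0r mul1r !add0r; case: leqP => //; lia.
  by rewrite !mul0r !addr0; case: andP => // -[]; lia.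
move=> iM /andP[j0]; rewrite leq_eqVlt => /predU1P[jM|jM]; last first.
  by apply: hlow; rewrite ?j0.
case/andP: iM => i0; rewrite leq_eqVlt => /predU1P[iM|iM].
  rewrite jM -iM /banded leqnSn /=.
  have [|-> _] := step i; first by rewrite i0 iM /=.
  rewrite (ipBr axioms) (ip_act axioms) lanczos_orthonormal ?iM//; last by rewrite leq_pred.
  by rewrite gtn_eqF ?mul0r ?subr0// -iM prednK.
rewrite -(ip_op axioms) -(ip_star axioms) hlow ?i0 ?j0 ?jM/= ?iM// /banded andbC -jM.
have [ij|ij] := ltnP j i; first lia.
case: (leqP j i.+1) => ji; last by rewrite /= ?andbF /= (star0 axioms).
have -> : j = i.+1 by lia.
have -> : (i <= i.+2)%N by lia.
rewrite /=.
by have [|_ /(_ iM)[_ _ -> _]] := step i; first by rewrite i0 ltnW.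
Qed.
End AbstractLanczos.

(** * Global and ordinary Lanczos methods *)

Section ScalarLanczos.
Variables (R : realType) (n N : nat) (L : 'M[R]_n) (M : nat).
Variables (Q : nat -> 'M[R]_(n, N)) (h : nat -> nat -> R).

(** The common form of the global and of the ordinary Lanczos recurrences. *)
Definition scalar_run : Prop :=
  [/\ Q 0%N = 0, frobenius (Q 1%N) = 1 &
    forall k, (0 < k <= M)%N ->
      let X := L *m Q k - h k.-1 k *: Q k.-1 in
      let X' := X - h k k *: Q k in
      h k k = \tr ((Q k)^T *m X) /\
      ((k < M)%N ->
        [/\ h k.+1 k = frobenius X', h k k.+1 = frobenius X' &
            Q k.+1 = (h k.+1 k)^-1 *: X'])].

Definition trdot (A B : 'M[R]_(n, N)) : R := \tr (A^T *m B).

Lemma trdotC A B : trdot A B = trdot B A.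
Proof. by rewrite /trdot -mxtrace_tr trmx_mul trmxK. Qed.

Lemma trdotZr A c B : trdot A (c *: B) = c * trdot A B.
Proof. by rewrite /trdot -scalemxAr linearZ. Qed.

Lemma trdot_sumr A (I : finType) (F : I -> 'M[R]_(n, N)) :
  trdot A (\sum_i F i) = \sum_i trdot A (F i).
Proof. by rewrite /trdot mulmx_sumr linear_sum. Qed.

Lemma trdot_mull A B : L^T = L -> trdot (L *m A) B = trdot A (L *m B).
Proof. by move=> Ls; rewrite /trdot trmx_mul Ls mulmxA. Qed.

Lemma scalar_run_recurrence : scalar_run ->
  (forall k, (0 < k < M)%N -> h k.+1 k != 0) ->
  lanczos_recurrence id (fun A (c : R) => c *: A) trdot (mulmx L) M Q h.
Proof.
move=> [Q0 Q1 step] hne; split=> // [|k kM].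
  by rewrite /trdot -frobenius2_tr -sqr_frobenius Q1 expr1n.
have [hkk {}step] := step k kM; split=> // ltkM; have [hE hE' QE] := step ltkM.
have hk : h k.+1 k != 0 by apply: hne; rewrite ltkM andbT; case/andP: kM.
split=> //.
- by rewrite QE scalerA mulfV// scale1r.
- rewrite /trdot -frobenius2_tr -sqr_frobenius QE frobeniusZ -hE.
  by rewrite ger0_norm ?mulVf ?expr1n// invr_ge0 hE frobenius_ge0.
- by rewrite hE hE'.
- by exists (h k.+1 k)^-1; rewrite mulfV.
Qed.

Lemma scalar_axioms : L^T = L ->
  inner_product_axioms id (fun A (c : R) => c *: A) trdot (mulmx L).
Proof.
move=> Ls; split=> //.
- by move=> A B C; rewrite /trdot mulmxBr linearB.
- by move=> A B c; rewrite trdotZr mulrC.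
- by move=> A B; rewrite trdotC.
- by move=> A B; exact: trdot_mull.
- by move=> A; rewrite scale0r.
- by move=> c; rewrite scaler0.
Qed.

Definition combination (x : 'cV[R]_M) : 'M[R]_(n, N) := \sum_(k < M) x k 0 *: Q k.+1.

Lemma combination_is_linear : linear combination.
Proof.
move=> c x y; rewrite /combination scaler_sumr -big_split /=; apply: eq_bigr => k _.
by rewrite !mxE scalerDl scalerA.
Qed.
HB.instance Definition _ := GRing.isLinear.Build R 'cV[R]_M 'M[R]_(n, N) _
  combination combination_is_linear.

(** The combinations of the basis form an isometric image of the coordinate space,
    on which the tridiagonal matrix is the compression of L. *)
Lemma scalar_lanczos_error (m : nat) (phi : R -> R) (Lambda e : R) (p : {poly R}) :
  M = m.+1 ->
  L^T = L -> rayleigh_in Lambda L -> scalar_run ->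
  (forall k, (0 < k < M)%N -> h k.+1 k != 0) ->
  (size p <= m.+1)%N -> 0 <= e ->
  (forall x, 0 <= x <= Lambda -> `|phi x - p.[x]| <= e) ->
  frobenius (matfun phi L *m Q 1%N
     - combination (matfun phi (tridiag_mx M h) *m first_unit R M)) <= 2 * e.
Proof.
move=> Mm Ls LL run hne sp e0 pe; have rec := scalar_run_recurrence run hne.
have [Q0 _ _] := run; have ax := scalar_axioms Ls.
have ortho := lanczos_orthonormal ax rec.
have entry := lanczos_entry ax rec.
have column := lanczos_column ax rec.
set T := tridiag_mx M h.
have TE i j : T i j = trdot (Q i.+1) (L *m Q j.+1).
  by rewrite entry ?ltn_ord// mxE /banded !ltnS.
have dotV x Z : trdot (combination x) Z = \sum_k x k 0 * trdot (Q k.+1) Z.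
  rewrite trdotC trdot_sumr; apply: eq_bigr => k _.
  by rewrite trdotZr trdotC.
have dot_cV (x y : 'cV[R]_M) : \tr (x^T *m y) = \sum_k x k 0 * y k 0.
  by rewrite /mxtrace big_ord1 mxE; apply: eq_bigr => k _; rewrite mxE.
have Tsym : T^T = T.
  by apply/matrixP => i j; rewrite mxE !TE -trdot_mull// trdotC.
have LV x : L *m combination x = \sum_(k < M) x k 0 *: (L *m Q k.+1).
  by rewrite mulmx_sumr; apply: eq_bigr => k _; rewrite scalemxAr.
have Viso x : frobenius2 (combination x) = frobenius2 x.
  rewrite !frobenius2_tr -/(trdot _ _) dotV dot_cV; apply: eq_bigr => k _.
  congr (_ * _); rewrite trdotC dotV (bigD1 k)//= ortho// eqxx mulr1.
  rewrite big1 ?addr0// => l; rewrite -val_eqE => /= lk.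
  by rewrite ortho// eqSS (negPf lk) mulr0.
have TL : rayleigh_in Lambda T.
  move=> x; have := rayleigh_in_mx (combination x) LL.
  rewrite -[\tr (_^T *m combination x)]frobenius2_tr Viso frobenius2_tr.
  suff -> : \tr ((combination x)^T *m (L *m combination x)) = \tr (x^T *m (T *m x)) by [].
  rewrite -/(trdot _ _) dotV dot_cV; apply: eq_bigr => k _; congr (_ * _).
  rewrite LV trdot_sumr mxE; apply: eq_bigr => l _.
  by rewrite trdotZr TE mulrC.
have VB : combination (first_unit R M) = Q 1%N.
  rewrite /combination; case: (M) Mm => // M' _; rewrite big_ord_recl mxE /= scale1r.
  by rewrite big1 ?addr0// => k _; rewrite mxE scale0r.
have B1 : frobenius (first_unit R M) = 1.
  have : 0 <= frobenius (first_unit R M) by exact: frobenius_ge0.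
  move=> B0; apply/eqP; rewrite -(@eqrXn2 _ 2)// sqr_frobenius -Viso VB -sqr_frobenius.
  by have [_ -> _] := run.
have -> : 2 * e = 2 * (e * frobenius (first_unit R M)) by rewrite B1 mulr1.
rewrite -VB.
apply: (@krylov_error _ _ _ _ _ _ _ combination _ Lambda phi m p) => //.
  by move=> X; rewrite /frobenius -!/(frobenius2 _) Viso.
apply: (@krylov_powers _ _ _ _ _ _ _ _ _ (fun i => i : nat)).
- by move=> i j ij; rewrite mxE leqNgt ij.
- by move=> i c; rewrite lt0n mxE => /negPf->.
move=> y y0; rewrite LV /combination.
under [RHS]eq_bigr do rewrite mxE scaler_suml.
rewrite exchange_big; apply: eq_bigr => k _ /=.
have [mk|km] := leqP m k.
  by rewrite y0// scale0r big1// => i _; rewrite mulr0 scale0r.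
have -> : L *m Q k.+1 = \sum_(i < M) banded h i.+1 k.+1 *: Q i.+1.
  by apply: column; move: km; rewrite -ltnS -Mm.
rewrite scaler_sumr; apply: eq_bigr => i _.
by rewrite mxE /banded !ltnS scalerA mulrC.
Qed.
End ScalarLanczos.

(** * Classical block Lanczos method *)

Section BlockLanczos.
Variables (R : realType) (n N : nat) (L : 'M[R]_n) (M : nat).
Variables (Q : nat -> 'M[R]_(n, N)) (H : nat -> nat -> 'M[R]_N).

Lemma block_axioms : L^T = L -> inner_product_axioms (trmx : 'M[R]_N -> 'M[R]_N)
  (fun A c => A *m c) (fun A B : 'M[R]_(n, N) => A^T *m B) (mulmx L).
Proof.
move=> Ls; split=> //.
- exact: trmx0.
- by move=> A B C; rewrite mulmxBr.
- by move=> A B c; rewrite mulmxA.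
- by move=> A B; rewrite trmx_mul trmxK.
- by move=> A B; rewrite trmx_mul Ls mulmxA.
- by move=> A; rewrite mulmx0.
- by move=> c; rewrite mul0mx.
Qed.

Lemma cbl_run_recurrence (E : 'M[R]_(n, N)) : E^T *m E = 1%:M ->
  cbl_run L E M Q H -> (forall k, (0 < k < M)%N -> H k.+1 k \in unitmx) ->
  lanczos_recurrence (trmx : 'M[R]_N -> 'M[R]_N)
    (fun A c => A *m c) (fun A B : 'M[R]_(n, N) => A^T *m B) (mulmx L) M Q H.
Proof.
move=> E1 [Q0 _ QE step] Hu; split=> // [|k kM]; first by rewrite QE.
have [hkk {}step] := step k kM; split=> // ltkM.
have [hE Q1 _ hT] := step ltkM; split=> //.
have Hk : H k.+1 k \in unitmx by apply: Hu; rewrite ltkM andbT; case/andP: kM.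
by exists (invmx (H k.+1 k)); exact: mulmxV.
Qed.

(** The isometry is multiplication by the row W of all basis blocks, and the block
    tridiagonal matrix is the compression W^T *m (L *m W). *)
Lemma cbl_error (m : nat) (phi : R -> R) (Lambda e : R) (E : 'M[R]_(n, N))
    (p : {poly R}) : M = m.+1 ->
  L^T = L -> rayleigh_in Lambda L -> E^T *m E = 1%:M -> cbl_run L E M Q H ->
  (forall k, (0 < k < M)%N -> H k.+1 k \in unitmx) ->
  (size p <= m.+1)%N -> 0 <= e ->
  (forall x, 0 <= x <= Lambda -> `|phi x - p.[x]| <= e) ->
  frobenius (matfun phi L *m E - cbl_approx phi M Q H) <= 2 * (e * frobenius E).
Proof.
move=> Mm Ls LL E1 run Hu sp e0 pe; have rec := cbl_run_recurrence E1 run Hu.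
have [_ _ QE _] := run; have ax := block_axioms Ls.
have ortho := lanczos_orthonormal ax rec.
have entry := lanczos_entry ax rec.
have column := lanczos_column ax rec.
set T := cbl_mx M H.
pose W := \mxrow_(k < M) Q k.+1.
pose F : 'M[R]_(\sum_(i < M) N, N) :=
  \mxcol_(k < M) (if k == 0%N :> nat then 1%:M else 0 : 'M[R]_N).
have WW : W^T *m W = 1%:M.
  rewrite tr_mxrow mul_mxcol_mxrow -mxdiagZ; apply: eq_mxblock => i j.
  rewrite ortho// eqSS andbT val_eqE.
  by case: eqVneq => _ /=; rewrite ?conform_mx_id.
have TW : T = W^T *m (L *m W).
  rewrite mul_mxrow tr_mxrow mul_mxcol_mxrow; apply: eq_mxblock => i j.
  by rewrite entry ?ltn_ord// /banded !ltnS.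
have Tsym : T^T = T by rewrite TW !trmx_mul trmxK Ls mulmxA.
have Viso X : frobenius2 (W *m X) = frobenius2 X :> R.
  by rewrite !frobenius2_tr trmx_mul mulmxA -(mulmxA X^T) WW mulmx1.
have TL : rayleigh_in Lambda T.
  move=> x; have := LL (W *m x); rewrite trmx_mul -!mulmxA.
  by rewrite (mulmxA W^T W) WW mul1mx TW !mulmxA.
have VF : W *m F = E.
  rewrite mul_mxrow_mxcol; case: (M) Mm => // M' _.
  rewrite big_ord_recl /= mulmx1 big1 ?addr0// => k _.
  by rewrite mulmx0.
have F1 : frobenius F = frobenius E.
  by rewrite -VF /frobenius -!/(frobenius2 _) Viso.
have -> : cbl_approx phi M Q H = W *m (matfun phi T *m F) by rewrite mulmxA.
rewrite -F1 -{1}VF.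
apply: (@krylov_error _ _ _ _ _ _ _ (mulmx W) _ Lambda phi m p) => //.
  by move=> X; rewrite /frobenius -!/(frobenius2 _) Viso.
apply: (@krylov_powers _ _ _ _ _ _ _ _ _ (fun i => tagnat.sig1 i : nat)).
- by move=> i j ij; rewrite mxE leqNgt ij /= mxE.
- by move=> i c; rewrite mxE lt0n => /negPf->; rewrite mxE.
move=> y y0; rewrite /= !mulmxA; apply/eqP; rewrite -subr_eq0 -mulmxBl; apply/eqP.
rewrite mul_mxrow mul_mxrow_mxblock -mxrowB -(submxcolK y) mul_mxrow_mxcol.
apply: big1 => j _; have [mj|jm] := leqP m j.
  rewrite (_ : submxcol y j = 0) ?mulmx0//; apply/matrixP => i c.
  by rewrite mxE y0 ?mxE// tagnat.Rank1K.
have -> : L *m Q j.+1 = \sum_(i < M) Q i.+1 *m banded H i.+1 j.+1.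
  by apply: column; move: jm; rewrite -ltnS -Mm.
by rewrite (eq_bigr (fun i : 'I_M => Q i.+1 *m banded H i.+1 j.+1)) ?subrr ?mul0mx.
Qed.
End BlockLanczos.

(** * From polynomials to the best approximation error *)

Section BestApproximation.
Variable R : realType.

(** A bound by the error of every polynomial passes to the infimum; the
    inequality is trivial for the polynomials of infinite error. *)
Lemma le_best_approx_error (phi : R -> R) (Lambda c x : R) (m : nat) :
  0 < Lambda -> 0 <= c -> (c = 0 -> x <= 0) ->
  (forall (p : {poly R}) e, (size p <= m.+1)%N -> 0 <= e ->
     (forall y, 0 <= y <= Lambda -> `|phi y - p.[y]| <= e) -> x <= c * e) ->
  (x%:E <= c%:E * best_approx_error phi Lambda m)%E.
Proof.
move=> L0; rewrite le_eqVlt => /predU1P[<- x0 _|c0 _ xle].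
  by rewrite mul0e lee_fin x0.
rewrite -lee_pdivrMl//; apply: le_ereal_inf_tmp => _ [p /= sp <-].
set s := ereal_sup _.
have les y : 0 <= y <= Lambda -> (`|phi y - p.[y]|%:E <= s)%E.
  by move=> y0L; apply: ereal_sup_ubound; exists y => //=; rewrite in_itv.
have s0 : (0 <= s)%E by rewrite (le_trans _ (les 0 _)) ?lee_fin ?normr_ge0 ?lexx ?(ltW L0).
case: s s0 les => [r r0 les|_ _|//]; last exact: leey.
rewrite -EFinM lee_fin ler_pdivrMl//.
by apply: (xle p) => // y /les; rewrite lee_fin.
Qed.

Lemma horner_mx_matfun n (A : 'M[R]_n.+1) (p : {poly R}) : A^T = A ->
  horner_mx A p = matfun (fun x => p.[x]) A.
Proof.
move=> Asym; rewrite matfun_horner// -[in LHS](coefK p) poly_def rmorph_sum /=.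
apply: eq_bigr => k _; rewrite -mul_polyC rmorphM /= horner_mx_C rmorphXn /= horner_mx_X.
by rewrite -mulmxE mul_scalar_mx.
Qed.

(** The ordinary method is the global one for blocks with a single column. *)
Lemma lanczos_error n (L : 'M[R]_n) (m : nat) (q : nat -> 'cV[R]_n) h i0
    (phi : R -> R) (Lambda e : R) (p : {poly R}) :
  L^T = L -> rayleigh_in Lambda L -> lanczos_run L (delta_mx i0 0) m.+1 q h ->
  (forall k, (0 < k < m.+1)%N -> h k.+1 k != 0) ->
  (size p <= m.+1)%N -> 0 <= e ->
  (forall x, 0 <= x <= Lambda -> `|phi x - p.[x]| <= e) ->
  frobenius (matfun phi L *m delta_mx i0 0 - lanczos_approx phi m.+1 q h) <= 2 * e.
Proof.
move=> Ls LL [q0 _ qE step] hne sp e0 pe.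
have frob1 (x : 'cV[R]_n) : norm2 x = frobenius x.
  by congr Num.sqrt; apply: eq_bigr => i _; rewrite big_ord1.
have tr1 (X : 'M[R]_1) : X 0 0 = \tr X by rewrite /mxtrace big_ord1.
have run : scalar_run L m.+1 q h.
  split=> // [|k km].
    rewrite qE /frobenius (_ : \sum_i _ = 1) ?sqrtr1// -/(frobenius2 _) frobenius2_tr.
    by rewrite trmx_delta mul_delta_mx -tr1 mxE.
  by have [-> {}step] := step k km; split; [exact: tr1 | rewrite -!frob1].
rewrite -qE; suff -> : lanczos_approx phi m.+1 q h =
    combination q (matfun phi (tridiag_mx m.+1 h) *m first_unit R m.+1).
  exact: (scalar_lanczos_error erefl Ls LL run hne sp e0 pe).
rewrite /lanczos_approx -mulmxA; move: (_ *m first_unit _ _) => v.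
apply/matrixP => i j; rewrite (ord1 j) mxE summxE; apply: eq_bigr => k _.
by rewrite !mxE mulrC.
Qed.
End BestApproximation.

Theorem theorem4p2 (R : realType) (n N : nat) (L : 'M[R]_n.+1) (Lambda : R)
    (phi : R -> R) (w : 'I_N -> 'I_n.+1)
    (L_sym : L^T = L) (Lambda_gt0 : 0 < Lambda)
    (L_spec : forall a : R, eigenvalue L a -> 0 <= a <= Lambda)
    (phi_gt0 : forall x : R, 0 <= x <= Lambda -> 0 < phi x)
    (w_inj : injective w) :
  [/\ (* cbl *)
      forall (m : nat) (Q : nat -> 'M[R]_(n.+1, N)) (H : nat -> nat -> 'M[R]_N),
        cbl_run L (unit_block R w) m.+1 Q H ->
        (forall k, (0 < k < m.+1)%N -> H k.+1 k \in unitmx) ->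
        ((frobenius (matfun phi L *m unit_block R w
                     - cbl_approx phi m.+1 Q H))%:E
         <= (2 * Num.sqrt N%:R)%:E * best_approx_error phi Lambda m)%E,
      (* gbl *)
      forall (m : nat) (Q : nat -> 'M[R]_(n.+1, N)) (h : nat -> nat -> R),
        gbl_run L (unit_block R w) m.+1 Q h ->
        (forall k, (0 < k < m.+1)%N -> h k.+1 k != 0) ->
        ((frobenius (matfun phi L *m unit_block R w
                     - gbl_approx phi m.+1 Q h))%:E
         <= (2 * Num.sqrt N%:R)%:E * best_approx_error phi Lambda m)%E,
      (* sbl *)
      forall (m : nat) (q : 'I_N -> nat -> 'cV[R]_n.+1)
             (h : 'I_N -> nat -> nat -> R),
        (forall i, lanczos_run L (delta_mx (w i) 0) m.+1 (q i) (h i)) ->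
        (forall i k, (0 < k < m.+1)%N -> h i k.+1 k != 0) ->
        ((frobenius (matfun phi L *m unit_block R w
                     - sbl_approx phi m.+1 q h))%:E
         <= (2 * Num.sqrt N%:R)%:E * best_approx_error phi Lambda m)%E &
      (* cheb *)
      forall m : nat, (0 < m)%N ->
        ((frobenius (matfun phi L *m unit_block R w
                     - horner_mx L (cheb_poly phi Lambda m) *m unit_block R w))%:E
         <= (Num.sqrt N%:R * (2 + 2 / pi * ln (m.+1)%:R))%:E
            * best_approx_error phi Lambda m)%E].
Proof.
have LL := spectrum_rayleigh_in L_sym L_spec.
have sN : 0 <= Num.sqrt N%:R :> R by exact: sqrtr_ge0.
set E := unit_block R w.
have EE : E^T *m E = 1%:M.
  apply/matrixP => i j; rewrite !mxE (bigD1 (w i))//= !mxE eqxx mul1r.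
  rewrite big1 ?addr0 ?(inj_eq w_inj)// => k /negPf kw.
  by rewrite !mxE kw mul0r.
have E2 : frobenius2 E = N%:R by rewrite frobenius2_tr EE mxtrace1.
have E1 : frobenius E = Num.sqrt N%:R by rewrite -E2.
have sq : Num.sqrt N%:R ^+ 2 = N%:R :> R by rewrite -E1 sqr_frobenius E2.
(* If N = 0 there are no entries; then Q_1 of the global method has norm 0, not 1. *)
have N0 (A : 'M[R]_(n.+1, N)) : N = 0%N -> frobenius A <= 0.
  move=> NE; rewrite frobenius_le// expr0n; apply: sumr_le0 => i _.
  by rewrite big1// => j; case: (j : 'I_N) => j' j'N; exfalso; move: j'N; rewrite NE.
have c2 : 2 * Num.sqrt N%:R = 0 :> R -> N = 0%N.
  move=> /eqP; rewrite mulf_eq0 pnatr_eq0 /= => /eqP s0.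
  by apply/eqP; rewrite -(pnatr_eq0 R) -sq s0 expr0n.
split.
- move=> m Q H run Hu; apply: le_best_approx_error; rewrite ?mulr_ge0//.
    by move=> /c2; exact: N0.
  move=> p e sp e0 pe; rewrite -E1 mulrAC -mulrA.
  exact: (cbl_error erefl L_sym LL EE run Hu sp e0 pe).
- move=> m Q h [Q0 h0 QE step] hne; apply: le_best_approx_error; rewrite ?mulr_ge0//.
    by move=> /c2; exact: N0.
  move=> p e sp e0 pe; have [NE|Npos] := posnP N.
    by rewrite (le_trans (N0 _ NE)) ?mulr_ge0.
  have s0 : 0 < Num.sqrt N%:R :> R by rewrite sqrtr_gt0 ltr0n.
  have run : scalar_run L m.+1 Q h.
    split=> //; rewrite QE frobeniusZ E1 ger0_norm ?invr_ge0// mulVf//.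
    by rewrite gt_eqF.
  have EQ : E = Num.sqrt N%:R *: Q 1%N by rewrite QE scalerA mulfV ?gt_eqF// scale1r.
  set v := matfun phi (tridiag_mx m.+1 h) *m first_unit R m.+1.
  have -> : gbl_approx phi m.+1 Q h = Num.sqrt N%:R *: combination Q v.
    by rewrite scaler_sumr; apply: eq_bigr => k _; rewrite mxE scalerA.
  rewrite {1}EQ -scalemxAr -scalerBr frobeniusZ ger0_norm//.
  rewrite [2 * _]mulrC -mulrA ler_wpM2l//.
  exact: (scalar_lanczos_error erefl L_sym LL run hne sp e0 pe).
- move=> m q h run hne; apply: le_best_approx_error; rewrite ?mulr_ge0//.
    by move=> /c2; exact: N0.
  move=> p e sp e0 pe.
  rewrite frobenius_le ?mulr_ge0// [X in _ <= X](_ : _ = N%:R * (2 * e) ^+ 2); last first.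
    by rewrite -[in RHS]sq; ring.
  rewrite /frobenius2 exchange_big /= mulr_natl -[X in _ *+ X]card_ord -sumr_const.
  apply: ler_sum => i _.
  have := lanczos_error L_sym LL (run i) (hne i) sp e0 pe.
  rewrite frobenius_le ?mulr_ge0//; apply: le_trans.
  apply: ler_sum => r _; rewrite big_ord1.
  suff -> : (matfun phi L *m E - sbl_approx phi m.+1 q h) r i =
    (matfun phi L *m delta_mx (w i) 0 - lanczos_approx phi m.+1 (q i) (h i)) r 0 by [].
  rewrite mxE [RHS]mxE; congr (_ + _); last by rewrite mxE [RHS]mxE [in LHS]mxE.
  rewrite !mxE; apply: eq_bigr => k _.
  by rewrite !mxE eqxx andbT.
move=> m m0.
have lc : 0 <= ln m.+1%:R :> R by rewrite ln_ge0// ler1n.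
have cc : 0 < 2 + 2 / pi * ln m.+1%:R :> R.
  by rewrite ltr_wpDr// mulr_ge0// divr_ge0// pi_ge0.
apply: le_best_approx_error; rewrite ?mulr_ge0 ?(ltW cc)//.
  move=> /eqP; rewrite mulf_eq0 (gt_eqF cc) orbF => /eqP s0; apply: N0.
  by apply: c2; rewrite s0 mulr0.
move=> p e sp e0 pe.
rewrite horner_mx_matfun// -mulmxBl -matfunB//.
rewrite -[leRHS]mulrA [leRHS]mulrC -E1.
apply: (matfun_mul_le _ L_sym LL); first by rewrite mulr_ge0// ltW.
by move=> x xL; exact: cheb_poly_error pe x xL.
Qed.
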